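(* Consider the $n$-dimensional quadratic Gaussian signaling game with zero-mean Gaussian source $\vec{M}$ with covariance matrix $\Sigma_{\vec{M}}$, zero-mean Gaussian channel noise $\vec{W}$ with covariance matrix $\Sigma_{\vec{W}}$, independent of $\vec M$, encoder cost $\|\vec{m}-\vec{u}-\vec{b}\|^2+\lambda\|\vec{x}\|^2$ and decoder cost $\|\vec{m}-\vec{u}\|^2$, with $\vec{b}\in\mathbb{R}^n$ and $\lambda\ge 0$. (1) If the encoder is linear (affine), the decoder, as a minimum mean-square error decoder for a Gaussian source over a Gaussian channel, is linear (affine). (2) If the decoder is linear (affine), then an optimal encoder policy for a multi-dimensional Gaussian source over a multi-dimensional Gaussian channel is an affine policy. (3) An equilibrium encoder policy $\gamma^e(\vec{m})=A\vec{m}+\vec{C}$ satisfies the equation $A=T(A)$, where $T(A)=(FF^T+\lambda I)^{-1}F$ and $F=(A\Sigma_{\vec{M}}A^T+\Sigma_{\vec{W}})^{-1}A\Sigma_{\vec{M}}$. (4) There exists at least one equilibrium.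
   Context: The encoder observes $\vec{m}\in\mathbb{R}^n$ and sends $\vec{x}=\gamma^e(\vec{m})\in\mathbb{R}^n$; the decoder receives $\vec{y}=\vec{x}+\vec{w}$ and chooses $\vec{u}=\gamma^d(\vec{y})\in\mathbb{R}^n$. In general, policies are stochastic kernels from $\mathbb{R}^n$ to $\mathbb{R}^n$; deterministic policies are measurable functions. The costs to be minimized are $J^e(\gamma^e,\gamma^d)=\mathbb{E}[\|\vec{m}-\vec{u}-\vec{b}\|^2+\lambda\|\vec{x}\|^2]$ for the encoder and $J^d(\gamma^e,\gamma^d)=\mathbb{E}[\|\vec{m}-\vec{u}\|^2]$ for the decoder; $\|\cdot\|$ is the Euclidean norm and $I$ the $n\times n$ identity. The value $\lambda=0$ corresponds to no power constraint at the encoder. ''Equilibrium'' means Nash equilibrium: a pair $(\gamma^{*,e},\gamma^{*,d})$ with $J^e(\gamma^{*,e},\gamma^{*,d})\le J^e(\gamma^e,\gamma^{*,d})$ for all $\gamma^e$ and $J^d(\gamma^{*,e},\gamma^{*,d})\le J^d(\gamma^{*,e},\gamma^d)$ for all $\gamma^d$. In (1) the decoder is the optimal response (minimizer of $J^d$) to the given encoder policy; in (2) the encoder is the optimal response (minimizer of $J^e$) to the given decoder policy. Affine policies have the form $\gamma^e(\vec{m})=A\vec{m}+\vec{C}$, $\gamma^d(\vec{y})=K\vec{y}+\vec{L}$ with $A,K\in\mathbb{R}^{n\times n}$, $\vec{C},\vec{L}\in\mathbb{R}^n$; linear means $\vec{C}=0$ (resp. $\vec{L}=0$).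
   Formalization: In (3), A=T(A) is proved when the inverses in T and F exist and the source covariance is nonsingular (it fails for singular covariance, as A can change off the source's support); in (2), optimal encoders are a.s. affine if K^TK+λI is invertible, otherwise some optimal encoder is affine. *)

(* Defs.v *)
From HB Require Import structures.
From mathcomp Require Import all_boot all_order all_algebra.
From mathcomp Require Import all_classical all_reals all_analysis.
From mathcomp Require Import measurable_realfun measurable_fun_approximation.
Set Implicit Arguments.
Unset Strict Implicit.
Unset Printing Implicit Defensive.
Import Order.TTheory GRing.Theory Num.Theory.
Import numFieldNormedType.Exports.
Local Open Scope classical_set_scope.
Local Open Scope ring_scope.

(* Column vectors carry the product sigma-algebra, generated by the coordinate
   maps, as n.-tuple does in measurable_structure.v; over a realType it is the
   Borel sigma-algebra of R^n. *)
Section measurable_cV.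
Context {d} {T : sigmaRingType d}.
Variable n : nat.

Definition cV_coord : 'I_n -> 'cV[T]_n -> T := fun i v => v i ord0.

Let cV_set0 : g_sigma_preimage cV_coord set0.
Proof. exact: sigma_algebra0. Qed.

Let cV_setC A : g_sigma_preimage cV_coord A -> g_sigma_preimage cV_coord (~` A).
Proof. exact: sigma_algebraC. Qed.

Let cV_bigcup (F : _^nat) : (forall i, g_sigma_preimage cV_coord (F i)) ->
  g_sigma_preimage cV_coord (\bigcup_i (F i)).
Proof. exact: sigma_algebra_bigcup. Qed.

HB.instance Definition _ := @isMeasurable.Build (measure_tuple_display d)
  'cV[T]_n (g_sigma_preimage cV_coord) cV_set0 cV_setC cV_bigcup.

End measurable_cV.

Lemma measurable_cV_coord d (T : sigmaRingType d) n (i : 'I_n) :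
  measurable_fun [set: 'cV[T]_n] (@cV_coord d T n i).
Proof.
move=> _ Y mY; rewrite setTI; apply: sub_sigma_algebra => /=.
rewrite -bigcup_seq/=; exists i => /=; first by rewrite mem_index_enum.
by exists Y => //; rewrite setTI.
Qed.

Lemma measurable_fun_cVP d1 d2 (T1 : measurableType d1) (T2 : measurableType d2)
    n (f : T1 -> 'cV[T2]_n) :
  measurable_fun [set: T1] f <->
  forall i, measurable_fun [set: T1] (fun x => f x i ord0).
Proof.
split=> [mf i|mf].
  exact: (measurableT_comp (@measurable_cV_coord _ T2 n i) mf).
move=> _ Y mY; rewrite setTI.
have : preimage_set_system setT f (g_sigma_preimage (@cV_coord _ T2 n))
         (f @^-1` Y) by exists Y => //; rewrite setTI.
rewrite -g_sigma_preimage_comp.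
apply: smallest_sub; first exact: sigma_algebra_measurable.
case: n => [|n] in f mf Y mY *; first by rewrite big_ord0.
rewrite -bigcup_mkord_ord; apply: bigcup_sub => i Ii.
by move=> A [B mB <-]; exact: mf.
Qed.

Section game.
Variables (R : realType) (n : nat).
Local Notation vec := 'cV[R]_n.

Definition sqnorm k (v : 'cV[R]_k) : R := \sum_(i < k) v i ord0 ^+ 2.

Lemma measurable_linear k (A : 'M[R]_(n, k)) (c : vec) :
  measurable_fun [set: 'cV[R]_k] (fun x : 'cV[R]_k => A *m x + c : vec).
Proof.
apply/measurable_fun_cVP => i.
under eq_fun do rewrite !mxE.
apply: measurable_funD => //.
apply: measurable_sum => j; apply: measurable_funM => //.
exact: (@measurable_cV_coord _ R k j).
Qed.

(* Law of a vector of k independent standard normal variables: such a law is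
   determined by its values on measurable boxes. *)
Definition iid_standard_normal k (P : probability 'cV[R]_k R) : Prop :=
  forall B : 'I_k -> set R, (forall i, measurable (B i)) ->
    P [set z : 'cV[R]_k | forall i, B i (z i ord0)] =
    (\prod_(i < k) normal_prob 0 1 (B i))%E.

(* P is the law of S Z for Z a vector of iid standard normal variables. The
   covariance matrix S S^T may be singular. *)
Definition centered_gaussian (P : probability vec R) (Sigma : 'M[R]_n) : Prop :=
  exists k (S : 'M[R]_(n, k)) (PZ : probability 'cV[R]_k R),
    [/\ iid_standard_normal PZ, S *m S^T = Sigma &
        forall U : set vec, measurable U ->
          P U = PZ [set z : 'cV[R]_k | U (S *m z)]].

Definition policy := R.-pker vec ~> vec.

Definition affine_policy (A : 'M[R]_n) (c : vec) : policy :=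
  kdirac (measurable_linear A c).

Variables (PM PW : probability vec R) (b : vec) (lambda : R).

(* The joint law of (m, x, w, u) is
   PM(dm) ge(dx | m) PW(dw) gd(du | x + w). The integrands are nonnegative and
   the costs may be infinite. *)
Definition expected (f : vec -> vec -> vec -> R) (ge gd : policy) : \bar R :=
  (\int[PM]_m \int[ge m]_x \int[PW]_w \int[gd (x + w)%R]_u (f m x u)%:E)%E.

Definition Je : policy -> policy -> \bar R :=
  expected (fun m x u => sqnorm (m - u - b) + lambda * sqnorm x).

Definition Jd : policy -> policy -> \bar R :=
  expected (fun m _ u => sqnorm (m - u)).

Definition optimal_encoder (gd ge : policy) : Prop :=
  forall ge' : policy, (Je ge gd <= Je ge' gd)%E.

Definition optimal_decoder (ge gd : policy) : Prop :=
  forall gd' : policy, (Jd ge gd <= Jd ge gd')%E.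

Definition nash (ge gd : policy) : Prop :=
  optimal_encoder gd ge /\ optimal_decoder ge gd.

(* At the observation x, the policy g outputs v with probability one. *)
Definition outputs (g : policy) (x v : vec) : Prop :=
  forall U : set vec, measurable U -> g x U = \d_v U.

(* invmx is the inverse of an invertible matrix and the identity function on
   singular ones, so these formulas are meaningful only when the matrices they
   invert are in unitmx. *)
Definition Fmap (SigmaM SigmaW A : 'M[R]_n) : 'M[R]_n :=
  invmx (A *m SigmaM *m A^T + SigmaW) *m A *m SigmaM.

Definition Tmap (SigmaM SigmaW A : 'M[R]_n) : 'M[R]_n :=
  let F := Fmap SigmaM SigmaW A in invmx (F *m F^T + lambda%:M) *m F.

End game.

(* Main.v *)
(* Decoder.  Write source and noise as M = S1 Z1 and W = S2 Z2, with
   Z = (Z1, Z2) a standard normal vector, so that the observation is T Z + C.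
   Solving the normal equations for K makes the error E Z = M - K (T Z + C) - L
   satisfy T E^T = 0.  For a row a of E, the reflection of Z along a fixes T Z
   and negates a.Z, and it preserves the law of Z; averaging a cost over the
   reflection kills the cross terms, so the cost of every decoder is that of
   the affine one plus its mean squared distance to it.  Only nonnegative
   integrals occur, so decoders of infinite cost need no separate treatment.
   The reflection invariance is obtained from the Cameron-Martin formula, which
   reduces to translation invariance of the Lebesgue measure on the line.

   Encoder.  Against an affine decoder the cost is a quadratic function of x
   for each m, and completing the square gives the best response.

   Equilibrium equation.  The equilibrium decoder is affine only almost surely
   along the equilibrium path, but its output stays known when the encoder
   deviates by a constant d on a set of messages, because shifts preserve null
   sets.  Ruling out these deviations, for d ranging over small multiples of
   basis vectors, forces the gradient of the quadratic cost to vanish.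

   Existence.  The zero policies form an equilibrium for every lambda >= 0. *)
Require Import Defs.
From HB Require Import structures.
From mathcomp Require Import all_boot all_order all_algebra.
From mathcomp Require Import all_classical all_reals all_analysis.
From mathcomp Require Import measurable_realfun measurable_fun_approximation.
From mathcomp Require Import ring lra.
Set Implicit Arguments.
Unset Strict Implicit.
Unset Printing Implicit Defensive.
Import Order.TTheory GRing.Theory Num.Theory.
Import numFieldNormedType.Exports.
Local Open Scope classical_set_scope.
Local Open Scope ring_scope.

(** * Normal equations *)

Section dot_product.
Variable R : realType.

Definition dot k (a b : 'cV[R]_k) : R := \sum_(i < k) a i ord0 * b i ord0.

Lemma dotE k (a b : 'cV[R]_k) : dot a b = (a^T *m b) ord0 ord0.
Proof. by rewrite /dot mxE; under [RHS]eq_bigr do rewrite mxE. Qed.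

Lemma dotC k (a b : 'cV[R]_k) : dot a b = dot b a.
Proof. by apply: eq_bigr => i _; rewrite mulrC. Qed.

Lemma dotDr k (a b c : 'cV[R]_k) : dot a (b + c) = dot a b + dot a c.
Proof. by rewrite !dotE mulmxDr mxE. Qed.

Lemma dotZr k (a b : 'cV[R]_k) t : dot a (t *: b) = t * dot a b.
Proof. by rewrite !dotE -scalemxAr mxE. Qed.

Lemma dotDl k (a b c : 'cV[R]_k) : dot (b + c) a = dot b a + dot c a.
Proof. by rewrite dotC dotDr !(dotC a). Qed.

Lemma dotZl k (a b : 'cV[R]_k) t : dot (t *: b) a = t * dot b a.
Proof. by rewrite dotC dotZr dotC. Qed.

Lemma dotNr k (a b : 'cV[R]_k) : dot a (- b) = - dot a b.
Proof. by rewrite -scaleN1r dotZr mulN1r. Qed.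

Lemma dotNl k (a b : 'cV[R]_k) : dot (- b) a = - dot b a.
Proof. by rewrite dotC dotNr dotC. Qed.

Lemma dot_mulmxl k l (A : 'M[R]_(k, l)) a b : dot (A *m a) b = dot a (A^T *m b).
Proof. by rewrite !dotE trmx_mul mulmxA. Qed.

Lemma sqnormE k (a : 'cV[R]_k) : sqnorm a = dot a a.
Proof. by apply: eq_bigr => i _; rewrite expr2. Qed.

Lemma sqnorm_ge0 k (a : 'cV[R]_k) : 0 <= sqnorm a.
Proof. by apply: sumr_ge0 => i _; rewrite sqr_ge0. Qed.

Lemma sqnorm_eq0 k (a : 'cV[R]_k) : (sqnorm a == 0) = (a == 0).
Proof.
apply/eqP/eqP => [/eqP|->]; last first.
  by rewrite /sqnorm big1// => i _; rewrite mxE expr0n.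
rewrite psumr_eq0 => [/allP a0|i _]; last exact: sqr_ge0.
apply/colP => i; rewrite mxE; apply/eqP.
by rewrite -sqrf_eq0; exact: a0 (mem_index_enum i).
Qed.

Lemma sqnorm0 k : sqnorm (0 : 'cV[R]_k) = 0.
Proof. by apply/eqP; rewrite sqnorm_eq0. Qed.

Lemma sqnormN k (a : 'cV[R]_k) : sqnorm (- a) = sqnorm a.
Proof. by apply: eq_bigr => i _; rewrite mxE sqrrN. Qed.

Lemma sqnormZ k (a : 'cV[R]_k) t : sqnorm (t *: a) = t ^+ 2 * sqnorm a.
Proof. by rewrite !sqnormE dotZl dotZr mulrA expr2. Qed.

Lemma sqnormD k (a b : 'cV[R]_k) :
  sqnorm (a + b) = sqnorm a + 2 * dot a b + sqnorm b.
Proof. rewrite !sqnormE !dotDl !dotDr (dotC b a); ring. Qed.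

End dot_product.

Section regularized_gram.
Variables (R : realType) (p q : nat) (K : 'M[R]_(p, q)) (lambda : R).
Hypothesis lambda_ge0 : 0 <= lambda.
Local Notation gram := (K^T *m K + lambda%:M).

Lemma dot_gram (x y : 'cV[R]_q) :
  dot x (gram *m y) = dot (K *m x) (K *m y) + lambda * dot x y.
Proof.
by rewrite mulmxDl dotDr mul_scalar_mx dotZr dot_mulmxl mulmxA.
Qed.

(** Both terms are nonnegative, hence vanish. The second conclusion is about [lambda *: x] because
    [lambda] may be zero. *)
Lemma gram_form_eq0 (x : 'cV[R]_q) :
  sqnorm (K *m x) + lambda * sqnorm x = 0 -> K *m x = 0 /\ lambda *: x = 0.
Proof.
move=> /eqP; rewrite paddr_eq0 ?mulr_ge0 ?sqnorm_ge0// mulf_eq0 !sqnorm_eq0.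
by move=> /andP[/eqP -> /orP[]/eqP ->]; rewrite ?scale0r ?scaler0.
Qed.

(** A column x of [N] satisfies |K x|^2 + lambda |x|^2 = x^T gram x = 0. *)
Lemma gram_ker r (N : 'M[R]_(q, r)) : gram *m N = 0 -> K *m N = 0.
Proof.
move=> KN0; apply/matrixP => i j; rewrite [RHS]mxE.
have /gram_form_eq0[+ _] : sqnorm (K *m col j N) + lambda * sqnorm (col j N) =
  0.
  rewrite !sqnormE -dot_gram colE mulmxA KN0 mul0mx dotE mulmx0 mxE//.
by move=> /colP/(_ i); rewrite colE mulmxA -colE !mxE.
Qed.

(* The normal equations are solvable even when the Gram matrix is singular. *)
Lemma normal_equations : exists G : 'M[R]_(q, p), gram *m G = K^T.
Proof.
(* The cokernel matrix of the Gram matrix is annihilated by it, hence by [K], so the rows of [K] lie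
   in its row space. Symmetry of the Gram matrix then transposes the factorisation. *)
have /submxP[D KD] : (K <= gram)%MS.
  by rewrite submxE gram_ker ?mulmx_coker.
exists D^T; rewrite [in RHS]KD trmx_mul; congr (_ *m _).
by rewrite linearD/= trmx_mul trmxK tr_scalar_mx.
Qed.

(** Exact second-order expansion at [x]: the vector paired with [d] is half the gradient. Completing
    the square and the stationarity argument both start from it. *)
Lemma regularized_residualD (v : 'cV[R]_p) (x d : 'cV[R]_q) :
  sqnorm (v - K *m (x + d)) + lambda * sqnorm (x + d) =
  sqnorm (v - K *m x) + lambda * sqnorm x +
  2 * dot d (gram *m x - K^T *m v) + (sqnorm (K *m d) + lambda * sqnorm d).
Proof.
rewrite dotDr dotNr dot_gram -dot_mulmxl mulmxDr opprD addrA.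
rewrite [sqnorm (_ - _ - _)]sqnormD [sqnorm (x + d)]sqnormD sqnormN.
rewrite dotNr dotC dotDr dotNr (dotC x d); ring.
Qed.

Lemma complete_square (v : 'cV[R]_p) (x x0 : 'cV[R]_q) :
    gram *m x0 = K^T *m v ->
  sqnorm (v - K *m x) + lambda * sqnorm x =
  sqnorm (v - K *m x0) + lambda * sqnorm x0 +
  (sqnorm (K *m (x - x0)) + lambda * sqnorm (x - x0)).
Proof.
move=> x0E; rewrite -{1 2}(subrKC x0 x) regularized_residualD x0E subrr.
by rewrite dotC -(scale0r 0) dotZl mul0r mulr0 addr0.
Qed.

End regularized_gram.

(** * Lebesgue and normal integrals on the line *)

Section integral_generalities.
Local Open Scope ereal_scope.
Context d (T : measurableType d) (R : realType).
Variable mu : {measure set T -> \bar R}.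
Implicit Types f g : T -> \bar R.

Lemma ge0_integral_eq0 f : measurable_fun setT f -> (forall x, 0 <= f x) ->
  \int[mu]_x f x = 0 -> {ae mu, forall x, f x = 0}.
Proof.
move=> mf f0 if0; have /(ae_eq_integral_abs mu measurableT mf) : 
    \int[mu]_x `|f x| = 0.
  by rewrite -[RHS]if0; apply: eq_integral => x _; rewrite gee0_abs.
by apply: filterS => x /(_ I).
Qed.

(** The finite integral of [f] cancels, leaving a nonnegative function of integral zero. In the
    game, [f] is the lower of two costs and [g] the excess of the other. *)
Lemma ge0_integralD_le_ae f g :
    measurable_fun setT f -> measurable_fun setT g ->
    (forall x, 0 <= f x) -> (forall x, 0 <= g x) ->
    \int[mu]_x f x + \int[mu]_x g x <= \int[mu]_x f x ->
    \int[mu]_x f x < +oo ->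
  {ae mu, forall x, g x = 0}.
Proof.
move=> mf mg f0 g0 le_fg foo; apply: ge0_integral_eq0 => //.
have ffin : \int[mu]_x f x \is a fin_num by rewrite ge0_fin_numE ?integral_ge0.
apply/eqP; rewrite eq_le integral_ge0 ?andbT//.
by move: le_fg; rewrite -[leRHS]adde0 leeD2lE.
Qed.

End integral_generalities.

Section lebesgue_isometries.
Variable R : realType.
Notation leb := (@lebesgue_measure R).

Let TR := measurableTypeR R.

Let mshift (t : R) : measurable_fun [set: TR] (fun x : TR => (x + t)%R : TR).
Proof.
have : measurable_fun [set: R] (fun x : R => x + t) by exact: measurable_funD.
exact.
Qed.

(** Uniqueness of the Lebesgue measure reduces the claim to half-open intervals, whose preimages
    under the shift have the same length. *)
Lemma lebesgue_measureD (t : R) (A : set TR) : measurable A ->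
  pushforward leb (fun x : TR => (x + t)%R : TR) A = leb A.
Proof.
pose tf : {mfun TR >-> TR} :=
  HB.pack (fun x : TR => (x + t)%R : TR) (isMeasurableFun.Build _ _ _ _ _
    (mshift t)).
move=> mA.
apply/esym/(@lebesgue_measure_unique _ (pushforward leb tf)) => //= _ [[a b]] _
  <-.
rewrite /pushforward/= /tf/=.
rewrite [X in _ = leb X](_ : _ = `]a - t, b - t]%classic).
  rewrite !lebesgue_measure_itv/= !lte_fin ltrD2r; case: ifP => // _.
  by rewrite -!EFinD; congr EFin; ring.
by apply/seteqP; split => x /=; rewrite !in_itv/= ltrBlDr lerBrDr.
Qed.

Lemma ge0_integral_lebesgueD (f : R -> \bar R) (t : R) :
  measurable_fun setT f -> (forall x, 0 <= f x)%E ->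
  (\int[leb]_x f (x + t)%R = \int[leb]_x f x)%E.
Proof.
move=> mf f0.
rewrite -[LHS](@ge0_integral_pushforward _ _ TR TR _ _ (mshift t) leb setT f)//.
by apply: eq_measure_integral => A mA _; exact: lebesgue_measureD.
Qed.

Lemma ge0_integral_lebesgueN (f : R -> \bar R) :
  measurable_fun setT f -> (forall x, 0 <= f x)%E ->
  (\int[leb]_x f (- x)%R = \int[leb]_x f x)%E.
Proof.
move=> mf f0.
have mN : measurable_fun [set: TR] (-%R : TR -> TR).
  have : measurable_fun [set: R] (-%R : R -> R) by exact: oppr_measurable.
  exact.
rewrite -[LHS](@ge0_integral_pushforward _ _ TR TR _ _ mN leb setT f)//.
by apply: eq_measure_integral => A mA _; exact: lebesgue_measureN.
Qed.

Lemma ge0_integral_lebesgueB (f : R -> \bar R) (t : R) :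
  measurable_fun setT f -> (forall x, 0 <= f x)%E ->
  (\int[leb]_x f (t - x)%R = \int[leb]_x f x)%E.
Proof.
move=> mf f0; rewrite -[RHS](ge0_integral_lebesgueD t)//.
under [LHS]eq_integral do rewrite addrC.
rewrite -[RHS]ge0_integral_lebesgueN//.
by apply: measurableT_comp => //; exact: measurable_funD.
Qed.

End lebesgue_isometries.

Section standard_normal.
Variable R : realType.
Notation leb := (@lebesgue_measure R).
Notation gauss := (@normal_prob R 0 1).
Notation pdf := (@normal_pdf R 0 1).

(** The normal density is a version of the Radon-Nikodym derivative, since both integrate to the
    same measure on every measurable set. *)
Lemma ge0_integral_normal_prob (f : R -> \bar R) :
  measurable_fun setT f -> (forall x, 0 <= f x)%E ->
  (\int[gauss]_x f x = \int[leb]_x (f x * (pdf x)%:E))%E.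
Proof.
move=> mf f0.
have dom : gauss `<< leb by exact: normal_prob_dominates.
rewrite -(Radon_Nikodym_SigmaFinite.change_of_variables dom)//.
have mpdf : measurable_fun setT (EFin \o pdf).
  by apply/measurable_EFinP; exact: measurable_normal_pdf.
have RNi := Radon_Nikodym_SigmaFinite.f_integrable dom.
have mRN := measurable_int _ RNi.
apply: ae_eq_integral => //; [exact: emeasurable_funM..|].
apply: ae_eqe_mul2l; apply: integral_ae_eq => // E _ mE.
by rewrite -Radon_Nikodym_SigmaFinite.f_integral.
Qed.

Lemma normal_pdfD (x t : R) :
  pdf (x - t) = expR (t * x - t ^+ 2 / 2) * pdf x.
Proof.
rewrite !normal_pdfE ?oner_eq0// /normal_fun mulrCA -expRD; congr (_ * expR _).
by rewrite expr1n; field.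
Qed.

(** One-dimensional Cameron-Martin formula: translation moves the shift from [f] to the density, and
    [normal_pdfD] gives the density ratio. *)
Lemma normal_prob_shift (f : R -> \bar R) (t : R) :
  measurable_fun setT f -> (forall x, 0 <= f x)%E ->
  (\int[gauss]_x f (x + t)%R =
   \int[gauss]_x (f x * (expR (t * x - t ^+ 2 / 2))%:E))%E.
Proof.
move=> mf f0.
have mexp : measurable_fun setT (fun x => (expR (t * x - t ^+ 2 / 2))%:E).
  apply/measurable_EFinP; apply: measurableT_comp => //.
  by apply: measurable_funB => //; exact: measurable_funM.
have mpdf s : measurable_fun setT (fun x : R => (pdf (x - s))%:E).
  apply/measurable_EFinP.
  by apply: measurableT_comp;
    [exact: measurable_normal_pdf|exact: measurable_funB].
rewrite !ge0_integral_normal_prob//.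
- rewrite -[LHS](ge0_integral_lebesgueD (- t)).
  + apply: eq_integral => x _; rewrite subrK -muleA -EFinM.
    by rewrite -normal_pdfD.
  + apply: emeasurable_funM.
      apply: measurableT_comp => //; exact: measurable_funD.
    by have := mpdf 0; under eq_fun do rewrite subr0.
  + by move=> x; rewrite mule_ge0// lee_fin normal_pdf_ge0.
- exact: emeasurable_funM.
- by move=> x; rewrite mule_ge0// lee_fin expR_ge0.
- by apply: measurableT_comp => //; exact: measurable_funD.
Qed.

End standard_normal.

(** * Measurability of column vectors *)

Section measurable_column_vectors.
Variable R : realType.

Lemma measurable_cV_entry k (i : 'I_k) :
  measurable_fun [set: 'cV[R]_k] (fun z : 'cV[R]_k => z i ord0).
Proof. exact: (@measurable_cV_coord _ R k i). Qed.

Section into_column_vectors.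
Context d (T : measurableType d).

Lemma measurable_fun_cVD k (f g : T -> 'cV[R]_k) :
  measurable_fun setT f -> measurable_fun setT g ->
  measurable_fun setT (fun x => f x + g x).
Proof.
move=> /measurable_fun_cVP mf /measurable_fun_cVP mg;
  apply/measurable_fun_cVP => i.
by under eq_fun do rewrite mxE; exact: measurable_funD.
Qed.

Lemma measurable_fun_cVZ k (f : T -> R) (g : T -> 'cV[R]_k) :
  measurable_fun setT f -> measurable_fun setT g ->
  measurable_fun setT (fun x => f x *: g x).
Proof.
move=> mf /measurable_fun_cVP mg; apply/measurable_fun_cVP => i.
by under eq_fun do rewrite mxE; exact: measurable_funM.
Qed.

Lemma measurable_fun_cVN k (f : T -> 'cV[R]_k) :
  measurable_fun setT f -> measurable_fun setT (fun x => - f x).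
Proof.
move=> mf; under eq_fun do rewrite -scaleN1r.
by apply: measurable_fun_cVZ.
Qed.

Lemma measurable_fun_cVB k (f g : T -> 'cV[R]_k) :
  measurable_fun setT f -> measurable_fun setT g ->
  measurable_fun setT (fun x => f x - g x).
Proof. by move=> mf mg; apply: measurable_fun_cVD => //;
  exact: measurable_fun_cVN. Qed.

Lemma measurable_fun_mulmx k p (A : 'M[R]_(p, k)) (f : T -> 'cV[R]_k) :
  measurable_fun setT f -> measurable_fun setT (fun x => A *m f x).
Proof.
move=> mf; have := measurableT_comp (measurable_linear A 0) mf.
by apply: eq_measurable_fun => x _ /=; rewrite addr0.
Qed.

Lemma measurable_fun_dot k (f g : T -> 'cV[R]_k) :
  measurable_fun setT f -> measurable_fun setT g ->
  measurable_fun setT (fun x => dot (f x) (g x)).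
Proof.
move=> /measurable_fun_cVP mf /measurable_fun_cVP mg.
by apply: measurable_sum => i; exact: measurable_funM.
Qed.

Lemma measurable_fun_sqnorm k (f : T -> 'cV[R]_k) :
  measurable_fun setT f -> measurable_fun setT (fun x => sqnorm (f x)).
Proof. by move=> mf; under eq_fun do rewrite sqnormE;
  exact: measurable_fun_dot. Qed.

End into_column_vectors.

Definition box k (B : 'I_k -> set R) : set 'cV[R]_k :=
  [set z | forall i, B i (z i ord0)].

Lemma measurable_box k (B : 'I_k -> set R) :
  (forall i, measurable (B i)) -> measurable (box B).
Proof.
move=> mB; rewrite (_ : box B =
  \bigcap_(i in [set: 'I_k]) (fun z : 'cV[R]_k => z i ord0) @^-1` B i).
  apply: fin_bigcap_measurable => [|i _]; first exact: finite_finset.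
  rewrite -[X in measurable X]setTI; exact: measurable_cV_entry.
by apply/seteqP; split => z /= zB i; [move=> _; exact: zB|exact: (zB i I)].
Qed.

(** Boxes form a generator stable under intersection, as uniqueness of measures requires. A cylinder
    over one coordinate is a box whose other sides are the whole line. *)
Lemma measurable_cV_boxes k : @measurable _ 'cV[R]_k =
  <<s [set box B | B in [set B : 'I_k -> set R | forall i,
    measurable (B i)]] >>.
Proof.
apply/seteqP; split; last first.
  apply: smallest_sub; first exact: sigma_algebra_measurable.
  by move=> _ [B mB <-]; exact: measurable_box.
apply: smallest_sub; first exact: smallest_sigma_algebra.
rewrite -bigcup_seq/=; apply: bigcup_sub => i _ _ [Y mY <-].
apply: sub_sigma_algebra; exists (fun j => if j == i then Y else setT).
  by move=> j; case: ifP.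
rewrite setTI; apply/seteqP; split => z /=; first by move=> /(_ i);
  rewrite eqxx.
by move=> Yz j; case: eqP => [->|].
Qed.

Lemma eq_measure_boxes k (m1 m2 : {measure set 'cV[R]_k -> \bar R}) :
    (m1 setT < +oo)%E ->
    (forall B, (forall i, measurable (B i)) -> m1 (box B) = m2 (box B)) ->
  forall A, measurable A -> m1 A = m2 A.
Proof.
move=> m1oo m12 A mA.
have boxT : box (fun=> setT) = [set: 'cV[R]_k] by apply/seteqP; split.
apply: (measure_unique _ (fun=> setT) (measurable_cV_boxes k)) => //.
- move=> _ _ [B mB <-] [C mC <-]; exists (fun i => B i `&` C i).
    by move=> i; exact: measurableI.
  apply/seteqP; split => z /= BC; first by split=> i; case: (BC i).
  by move=> i; split; [exact: BC.1|exact: BC.2].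
- by move=> _; exists (fun=> setT).
- by apply/seteqP; split=> // z _; exists 0%N.
- by move=> _ [B mB <-]; exact: m12.
Qed.

End measurable_column_vectors.

(** * Invariance of standard normal vectors *)

Section iid_standard_normal_law.
Variables (R : realType) (k : nat) (P : probability 'cV[R]_k R).
Hypothesis iidP : iid_standard_normal P.
Local Notation vec := 'cV[R]_k.
Notation leb := (@lebesgue_measure R).
Notation gauss := (@normal_prob R 0 1).
Let TR := measurableTypeR R.

Let measurable_sndR d (T : measurableType d) :
  measurable_fun [set: T * TR] (fun p => p.2 : R).
Proof. have : measurable_fun [set: T * TR] snd by []. exact. Qed.

Lemma iid_standard_normal_box (B : 'I_k -> set R) :
  (forall i, measurable (B i)) -> P (box B) = (\prod_(i < k) gauss (B i))%E.
Proof. exact: iidP. Qed.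

Definition set_entry (i : 'I_k) (z : vec) (x : R) : vec :=
  \col_j (if j == i then x else z j ord0).

Lemma measurable_set_entry i :
  measurable_fun [set: vec * TR] (fun p => set_entry i p.1 p.2).
Proof.
apply/measurable_fun_cVP => j; under eq_fun do rewrite mxE.
case: eqP => _; first exact: measurable_sndR.
by apply: (measurable_fun_cVP _).1; exact: measurable_fst.
Qed.

(** On a box, dropping the constraint on entry [i] and multiplying by the normal mass of that side
    restores the product. So an entry may be replaced by a fresh independent normal value. *)
Lemma pushforward_set_entry i (A : set vec) : measurable A ->
  (P \x gauss)%E ((fun p => set_entry i p.1 p.2) @^-1` A) = P A.
Proof.
pose ms : {mfun (vec * TR)%type >-> vec} :=
  HB.pack (fun p : vec * TR => set_entry i p.1 p.2)
  (isMeasurableFun.Build _ _ _ _ _ (measurable_set_entry i)).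
move=> mA; rewrite -/(pushforward _ ms A).
apply: (@eq_measure_boxes _ _ (pushforward (P \x gauss)%E ms) P) => //.
  by rewrite /= /pushforward preimage_setT (@probability_setT _ _ _ (P \x
    gauss)%E) ltry.
move=> B mB; rewrite /= /pushforward.
pose B' j := if j == i then setT else B j.
have mB' j : measurable (B' j) by rewrite /B'; case: ifP.
rewrite (_ : _ @^-1` _ = box B' `*` B i); last first.
  apply/seteqP; split=> -[z x] /=.
    move=> zB; split => [j|]; last by have := zB i; rewrite mxE eqxx.
    by rewrite /B'; case: eqP => // /eqP ji; have := zB j;
      rewrite mxE (negbTE ji).
  move=> [zB xB] j; rewrite mxE; case: eqP => [->//|/eqP ji].
  by have := zB j; rewrite /B' (negbTE ji).
rewrite product_measure1E; [|exact: measurable_box|exact: mB].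
rewrite -[LHS]/(P (box B') * gauss (B i))%E (iid_standard_normal_box mB')
  (iid_standard_normal_box mB).
rewrite (bigD1 i)//= [in RHS](bigD1 i)//=.
have -> : B' i = setT by rewrite /B' eqxx.
rewrite probability_setT mul1e muleC; congr (_ * _)%E.
by apply: eq_bigr => j ji; rewrite /B' (negbTE ji).
Qed.

(** Isolates the integration over one coordinate, so that one-dimensional formulas apply inside. *)
Lemma integral_set_entry i (F : vec -> \bar R) :
  measurable_fun setT F -> (forall z, 0 <= F z)%E ->
  (\int[P]_z \int[gauss]_x F (set_entry i z x) = \int[P]_z F z)%E.
Proof.
move=> mF F0.
rewrite -(fubini_tonelli1 (fun p : vec * TR => F (set_entry i p.1 p.2)))//;
  last first.
  by apply: measurableT_comp => //; exact: measurable_set_entry.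
rewrite -[LHS](@ge0_integral_pushforward _ _ (vec * TR)%type _ _ _
  (measurable_set_entry i) (P \x gauss)%E setT F)//.
apply: eq_measure_integral; first exact: measurable_set_entry.
  by move=> ? A mA _; exact: pushforward_set_entry.
Qed.

(** Density of the law of Z + a with respect to the law of Z. *)
Let cm_density (a z : vec) : R := expR (dot a z - sqnorm a / 2).

Let cm_density_ge0 a z : (0 <= (cm_density a z)%:E)%E.
Proof. by rewrite lee_fin expR_ge0. Qed.

Let measurable_cm_density d (T : measurableType d) (a : T -> vec) (z : T ->
  vec) :
  measurable_fun setT a -> measurable_fun setT z ->
  measurable_fun setT (fun x => (cm_density (a x) (z x))%:E).
Proof.
move=> ma mz; apply/measurable_EFinP; apply: measurableT_comp => //.
apply: measurable_funB; first exact: measurable_fun_dot.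
by apply: measurable_funM => //; exact: measurable_fun_sqnorm.
Qed.

Let cameron_martin_at (a : vec) := forall F : vec -> \bar R,
  measurable_fun setT F -> (forall z, 0 <= F z)%E ->
  (\int[P]_z F (z + a)%R = \int[P]_z (F z * (cm_density a z)%:E))%E.

(** After resampling entry [i] the shift acts on the fresh value alone, and [normal_prob_shift]
    applies with the other entries fixed. *)
Let cm_entry i t : cameron_martin_at (t *: delta_mx i ord0).
Proof.
have dotd z : dot (t *: delta_mx i ord0) z = t * z i ord0.
  rewrite dotZl dotC; congr (_ * _).
  rewrite /dot (bigD1 i)//= mxE !eqxx mulr1 big1 ?addr0// => j ji.
  by rewrite mxE (negbTE ji) mulr0.
have nd : sqnorm (t *: delta_mx i ord0 : vec) = t ^+ 2.
  by rewrite sqnormE dotd !mxE !eqxx mulr1 expr2.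
move=> F mF F0; rewrite /cm_density nd; under [RHS]eq_integral do rewrite dotd.
have mz : measurable_fun setT (fun z : vec => z + t *: delta_mx i ord0).
  by apply: measurable_fun_cVD.
rewrite -(integral_set_entry i)//; last exact: measurableT_comp.
have mexp d (T : measurableType d) (f : T -> R) : measurable_fun setT f ->
    measurable_fun setT (fun x => (expR (t * f x - t ^+ 2 / 2))%:E).
  move=> mf; apply/measurable_EFinP; apply: measurableT_comp => //.
  by apply: measurable_funB => //; exact: measurable_funM.
rewrite -[RHS](integral_set_entry i); last 2 first.
- by apply: emeasurable_funM => //; apply: mexp; exact: measurable_cV_entry.
- by move=> z; rewrite mule_ge0// lee_fin expR_ge0.
apply: eq_integral => z _.
rewrite -[RHS](_ : \int[gauss]_x (F (set_entry i z x) * (expR (t * x - t ^+ 2 /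
  2))%:E) = _)%E; last first.
  by apply: eq_integral => x _; rewrite mxE eqxx.
rewrite -(@normal_prob_shift _ (fun x => F (set_entry i z x)))//.
  apply: eq_integral => x _; congr F; apply/colP => j; rewrite !mxE eqxx andbT.
  by case: eqP => [_|_]; rewrite ?mulr1// mulr0 addr0.
apply: measurableT_comp => //; apply/measurable_fun_cVP => j.
under eq_fun do rewrite mxE.
by case: eqP => _; [exact: measurable_id|exact: measurable_cst].
Qed.

(** The formula is stable under adding shifts: the density for [a1] at z - a2 times the density for
    [a2] at z is the density for a1 + a2. Every shift is a sum of shifts along coordinates. *)
Lemma cameron_martin (a : vec) (F : vec -> \bar R) :
  measurable_fun setT F -> (forall z, 0 <= F z)%E ->
  (\int[P]_z F (z + a)%R =
   \int[P]_z (F z * (expR (dot a z - sqnorm a / 2))%:E))%E.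
Proof.
move: F; rewrite -/(cameron_martin_at a) (matrix_sum_delta a).
elim/big_ind: _ => [F mF F0|a1 a2 cm1 cm2 F mF F0|i _].
- apply: eq_integral => z _.
  by rewrite /cm_density addr0 sqnorm0 dotC -(scale0r 0) dotZr !mul0r subr0
    expR0 mule1.
- have mz (c : vec) : measurable_fun setT (fun z : vec => z + c) by exact:
  measurable_fun_cVD.
  transitivity (\int[P]_z (F (z + a2)%R * (cm_density a1 z)%:E))%E.
    rewrite -(cm1 (fun z => F (z + a2)))//;
      last exact: measurableT_comp mF (mz a2).
    by apply: eq_integral => z _; rewrite addrA.
  under eq_integral => z _ do rewrite -{2}[z](addrK a2).
  rewrite (cm2 (fun z => F z * (cm_density a1 (z - a2))%:E)%E).
  + apply: eq_integral => z _; rewrite -muleA -EFinM -expRD;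
    congr (_ * (expR _)%:E)%E.
    by rewrite dotDr dotNr dotDl sqnormD; field.
  + by apply: emeasurable_funM => //; apply: measurable_cm_density => //;
    exact: mz.
  + by move=> z; exact: mule_ge0.
- by rewrite big_ord1; exact: cm_entry.
Qed.

(** The shifted law has a density with respect to [P], so null sets stay null. This is what keeps
    the decoder known when the encoder deviates by a constant. *)
Lemma integral_shift_eq0 (a : vec) (F : vec -> \bar R) :
  measurable_fun setT F -> (forall z, 0 <= F z)%E ->
  (\int[P]_z F z = 0)%E -> (\int[P]_z F (z + a)%R = 0)%E.
Proof.
move=> mF F0 /(ge0_integral_eq0 mF F0) Fae0; rewrite cameron_martin//.
have mFd : measurable_fun setT (fun z => F z * (cm_density a z)%:E)%E.
  by apply: emeasurable_funM => //; exact: measurable_cm_density.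
transitivity (\int[P]_z cst 0 z)%E; last exact: integral0.
apply: ge0_ae_eq_integral => //.
- by move=> z _; exact: mule_ge0.
- by apply: filterS Fae0 => z Fz _; rewrite /= Fz mul0e.
Qed.

End iid_standard_normal_law.

(** * Invariance of standard normal laws under reflections *)

Section reflection_invariance.
Variables (R : realType) (k : nat) (P : probability 'cV[R]_k R).
Hypothesis iidP : iid_standard_normal P.
Local Notation vec := 'cV[R]_k.
Notation leb := (@lebesgue_measure R).
Notation pdf := (@normal_pdf R 0 1).
Let TR := measurableTypeR R.

Definition householder (a z : vec) : vec := z - (2 * dot a z / sqnorm a) *: a.

Lemma measurable_householder a : measurable_fun setT (householder a).
Proof.
apply: measurable_fun_cVB => //; apply: measurable_fun_cVZ => //.
apply: measurable_funM => //; apply: measurable_funM => //.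
exact: measurable_fun_dot.
Qed.

Section fixed_direction.
Variable a : vec.
Hypothesis a_neq0 : a != 0.
Let q := sqnorm a.

Let q_neq0 : q != 0. Proof. by rewrite sqnorm_eq0. Qed.

(** Up to a factor free of [s], this is a Gaussian profile in [s] centred at - dot a z / q, the
    value for which z + s a is orthogonal to [a]. *)
Let weight (z : vec) (s : R) : R :=
  pdf (- (dot a z / q)) * expR (- s * dot a z - s ^+ 2 * q / 2).

Let measurable_sndR : measurable_fun [set: vec * TR] (fun p => p.2 : R).
Proof. have : measurable_fun [set: vec * TR] snd by []. exact. Qed.

Let mdot : measurable_fun [set: vec * TR] (fun p => dot a p.1).
Proof. exact: measurable_fun_dot. Qed.

Let mpdf d (T : measurableType d) (f : T -> R) : measurable_fun setT f ->
  measurable_fun setT (fun x => pdf (f x)).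
Proof. by move=> mf; apply: measurableT_comp => //;
  exact: measurable_normal_pdf. Qed.

Let mweight : measurable_fun [set: vec * TR] (fun p => weight p.1 p.2).
Proof.
apply: measurable_funM.
  apply: mpdf; apply: measurableT_comp => //.
  exact: measurable_funM.
apply: measurableT_comp => //; apply: measurable_funB.
  by apply: measurable_funM => //; exact: measurableT_comp.
apply: measurable_funM => //; apply: measurable_funM => //.
exact: measurable_funX.
Qed.

Let mmove : measurable_fun [set: vec * TR] (fun p => p.1 + p.2 *: a).
Proof. by apply: measurable_fun_cVD => //; exact: measurable_fun_cVZ. Qed.

(* Averaging over s the Cameron-Martin formula for the shift by s *: a. *)
Let integral_resample (F : vec -> \bar R) :
  measurable_fun setT F -> (forall z, 0 <= F z)%E ->
  (\int[P]_z F z =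
   \int[P]_z \int[leb]_s (F (z + s *: a)%R * (weight z s)%:E))%E.
Proof.
move=> mF F0.
(* A normal density in [s], of mass one for each z, is inserted. Its centre dot a z / q makes its
   argument free of [s] once z is shifted by s a. *)
pose G (p : vec * TR) := (F p.1 * (pdf (p.2 - dot a p.1 / q))%:E)%E.
have mG : measurable_fun setT G.
  apply: emeasurable_funM; first exact: measurableT_comp mF measurable_fst.
  apply/measurable_EFinP/mpdf; apply: measurable_funB => //.
  exact: measurable_funM.
have G0 p : (0 <= G p)%E by rewrite mule_ge0// lee_fin normal_pdf_ge0.
transitivity (\int[P]_z \int[leb]_s G (z, s))%E.
  apply: eq_integral => z _; rewrite /G/= ge0_integralZl//.
  - rewrite (ge0_integral_lebesgueD (f :=
    fun s => (pdf s)%:E) (- (dot a z / q))).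
    + by rewrite integral_normal_pdf mule1.
    + by apply/measurable_EFinP; apply: mpdf.
    + by move=> s; rewrite lee_fin normal_pdf_ge0.
  - apply/measurable_EFinP/mpdf.
    have : measurable_fun [set: R] (fun s : R => s - dot a z / q).
      exact: measurable_funB.
    exact.
  - by move=> s _; rewrite lee_fin normal_pdf_ge0.
rewrite (fubini_tonelli (m1 := P) (m2 := leb) G)//.
rewrite (fubini_tonelli (m1 := P) (m2 := leb)
  (fun p : vec * TR => F (p.1 + p.2 *: a)%R * (weight p.1 p.2)%:E)%E);
    last 2 first.
- apply: emeasurable_funM; first exact: measurableT_comp mF mmove.
  exact/measurable_EFinP.
- by move=> p; rewrite mule_ge0// lee_fin mulr_ge0 ?normal_pdf_ge0 ?expR_ge0.
apply: eq_integral => s _ /=.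
(* [H] is [G] divided by the Cameron-Martin density for the shift s a, so integrating its shifted
   version gives back the integral of [G]. *)
pose H (z : vec) := (F z * (pdf (s - dot a z / q) *
  expR (- s * dot a z + s ^+ 2 * q / 2))%:E)%E.
have mdota : measurable_fun [set: vec] (dot a) by exact: measurable_fun_dot.
have mH : measurable_fun setT H.
  apply: emeasurable_funM => //; apply/measurable_EFinP; apply: measurable_funM.
    by apply: mpdf; apply: measurable_funB => //; exact: measurable_funM.
  apply: measurableT_comp => //; apply: measurable_funD => //.
  exact: measurable_funM.
have H0 z : (0 <= H z)%E.
  by rewrite mule_ge0// lee_fin mulr_ge0 ?normal_pdf_ge0 ?expR_ge0.
transitivity (\int[P]_z H (z + s *: a)%R)%E.
  rewrite (cameron_martin iidP)//; apply: eq_integral => z _.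
  rewrite /G /H/= -muleA -EFinM -[(_ * expR _ * _)%R]mulrA -expRD;
    congr (_ * _%:E)%E.
  rewrite dotZl sqnormZ -/q -[LHS]mulr1; congr (_ * _).
  rewrite -[LHS]expR0; congr expR; ring.
apply: eq_integral => z _; rewrite /H /weight;
  congr (_ * (pdf _ * expR _)%:E)%E.
  by rewrite dotDr dotZr -sqnormE -/q; field.
by rewrite dotDr dotZr -sqnormE -/q; field.
Qed.

Lemma integral_householder_neq0 (F : vec -> \bar R) :
  measurable_fun setT F -> (forall z, 0 <= F z)%E ->
  (\int[P]_z F (householder a z) = \int[P]_z F z)%E.
Proof.
move=> mF F0.
have mhouseholder := measurable_householder a.
rewrite (integral_resample (F := fun z => F (householder a z)))//; last first.
  exact: measurableT_comp mF mhouseholder.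
rewrite (integral_resample mF F0); apply: eq_integral => z _.
(* On the line of points z + s a the reflection sends s to c - s, and [weight z] is symmetric about
   c / 2. *)
pose c := - (2 * dot a z / q).
rewrite -[RHS](ge0_integral_lebesgueB c); last 2 first.
- apply: emeasurable_funM.
    apply: measurableT_comp => //; apply: measurable_fun_cVD => //.
    exact: measurable_fun_cVZ.
  have := measurableT_comp mweight (pair1_measurable z).
  by move=> h; apply/measurable_EFinP; exact: h.
- by move=> s; rewrite mule_ge0// lee_fin mulr_ge0 ?normal_pdf_ge0 ?expR_ge0.
apply: eq_integral => s _; congr (F _ * _%:E)%E.
  rewrite /householder dotDr dotZr -sqnormE -/q -addrA -scalerBl;
    congr (_ + _ *: _).
  by rewrite /c; field.
by rewrite /weight /c; congr (_ * expR _); field.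
Qed.

End fixed_direction.

(* For a = 0 the division in householder is by zero and householder a is the
   identity. *)
Lemma integral_householder (a : vec) (F : vec -> \bar R) :
  measurable_fun setT F -> (forall z, 0 <= F z)%E ->
  (\int[P]_z F (householder a z) = \int[P]_z F z)%E.
Proof.
have [->|a0] := eqVneq a 0; last exact: integral_householder_neq0.
by move=> _ _; apply: eq_integral => z _; rewrite /householder scaler0 subr0.
Qed.

Lemma dot_householder (a z : vec) : dot a (householder a z) = - dot a z.
Proof.
have [->|a0] := eqVneq a 0; first by rewrite -(scale0r 0) !dotZl !mul0r oppr0.
rewrite /householder dotDr dotNr dotZr -sqnormE divfK ?sqnorm_eq0//; ring.
Qed.

Lemma mulmx_householder p (T : 'M[R]_(p, k)) (a z : vec) :
  T *m a = 0 -> T *m householder a z = T *m z.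
Proof. by move=> Ta0; rewrite mulmxBr -scalemxAr Ta0 scaler0 subr0. Qed.

End reflection_invariance.

(** * Exponential and second moments of standard normal vectors *)

Section gaussian_moments.
Variables (R : realType) (k : nat) (P : probability 'cV[R]_k R).
Hypothesis iidP : iid_standard_normal P.

(** The Cameron-Martin formula for the constant function 1 says that its density has mass one;
    rescaling gives the moment generating function. *)
Lemma integral_expR_dot (a : 'cV[R]_k) :
  (\int[P]_z (expR (dot a z))%:E = (expR (sqnorm a / 2))%:E)%E.
Proof.
have mdota : measurable_fun [set: 'cV[R]_k] (dot a) by exact:
  measurable_fun_dot.
have mexp s : measurable_fun [set: 'cV[R]_k] (fun z => (expR (dot a z - s))%:E).
  by apply/measurable_EFinP; apply: measurableT_comp => //;
    exact: measurable_funB.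
have cm : (\int[P]_z (expR (dot a z - sqnorm a / 2))%:E = 1)%E.
  have := cameron_martin iidP a (F := cst 1%E) (measurable_cst _) (fun=> lee01).
  under [X in _ = X]eq_integral do rewrite mul1e.
  move=> <-; rewrite -[LHS]/(\int[P]_z (cst 1%E z))%E integral_cst//.
  by rewrite mul1e; exact: probability_setT.
have -> : (\int[P]_z (expR (dot a z))%:E =
    \int[P]_z ((expR (sqnorm a / 2))%:E * (expR (dot a z - sqnorm a /
      2))%:E))%E.
  by apply: eq_integral => z _; rewrite -EFinM -expRD subrKC.
rewrite ge0_integralZl//.
by rewrite cm mule1.
Qed.

(** Controls second moments by exponential ones; for x >= 0 it follows from 1 + x^2 / 2 <= exp x. *)
Lemma sqr_le_expR (x : R) : x ^+ 2 <= 2 * (expR x + expR (- x)).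
Proof.
wlog x0 : x / 0 <= x => [H|].
  have [/H//|/ltW x0] := leP 0 x.
  by rewrite -sqrrN addrC -[in expR x](opprK x) H// oppr_ge0.
have := expR_ge1Dxn 1 x0; have := expR_ge0 (- x).
by rewrite -[2`!]/2%N; lra.
Qed.

Lemma integral_sqr_dot_lty (a : 'cV[R]_k) :
  (\int[P]_z (dot a z ^+ 2)%:E < +oo)%E.
Proof.
have mdot b : measurable_fun [set: 'cV[R]_k] (dot b) by exact:
  measurable_fun_dot.
have mexp b : measurable_fun [set: 'cV[R]_k] (fun z => (expR (dot b z))%:E).
  by apply/measurable_EFinP; exact: measurableT_comp.
apply: (@le_lt_trans _ _
  (\int[P]_z (2%:E * ((expR (dot a z))%:E + (expR (dot (- a) z))%:E)))%E).
  apply: ge0_le_integral => //.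
  - by move=> z _; rewrite lee_fin sqr_ge0.
  - by apply/measurable_EFinP; exact: measurable_funX.
  - by apply: measurable_funeM; exact: emeasurable_funD.
  - move=> z _; rewrite dotNl -EFinD -EFinM lee_fin.
    exact: sqr_le_expR.
rewrite ge0_integralZl//; last 2 first.
- exact: emeasurable_funD.
- by move=> z _; rewrite adde_ge0// lee_fin expR_ge0.
rewrite ge0_integralD//; [|by move=> z _; rewrite lee_fin expR_ge0..].
by rewrite !integral_expR_dot -EFinD -EFinM ltry.
Qed.

Lemma mulmx_entry_dot p (A : 'M[R]_(p, k)) z i :
  (A *m z) i ord0 = dot (row i A)^T z.
Proof. by rewrite mxE; apply: eq_bigr => j _; rewrite !mxE. Qed.

Lemma integral_sqnorm_mulmx_lty p (A : 'M[R]_(p, k)) :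
  (\int[P]_z (sqnorm (A *m z))%:E < +oo)%E.
Proof.
have mAz i : measurable_fun [set: 'cV[R]_k] (fun z => (((A *m z) i ord0) ^+
  2)%:E).
  apply/measurable_EFinP; apply: measurable_funX.
  by apply: (measurable_fun_cVP _).1; exact: measurable_fun_mulmx.
rewrite /sqnorm; under eq_integral do rewrite -sumEFin.
rewrite ge0_integral_sum//; last by move=> i z _; rewrite lee_fin sqr_ge0.
apply: lte_sum_pinfty => i _; under eq_integral do rewrite mulmx_entry_dot.
exact: integral_sqr_dot_lty.
Qed.

End gaussian_moments.

(** * Joint law of independent standard normal vectors *)

Section joint_law.
Variables (R : realType) (k1 k2 : nat).
Variables (P1 : probability 'cV[R]_k1 R) (P2 : probability 'cV[R]_k2 R).
Hypotheses (iid1 : iid_standard_normal P1) (iid2 : iid_standard_normal P2).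

Let vstack (p : 'cV[R]_k1 * 'cV[R]_k2) : 'cV[R]_(k1 + k2) := col_mx p.1 p.2.

Let mvstack : measurable_fun setT vstack.
Proof.
apply/measurable_fun_cVP => i; case: (split_ordP i) => j ->.
  under eq_fun do rewrite col_mxEu.
  by apply: (measurable_fun_cVP _).1; exact: measurable_fst.
under eq_fun do rewrite col_mxEd.
by apply: (measurable_fun_cVP _).1; exact: measurable_snd.
Qed.

Let vstackX : {mfun ('cV[R]_k1 * 'cV[R]_k2)%type >-> 'cV[R]_(k1 + k2)} :=
  HB.pack vstack (isMeasurableFun.Build _ _ _ _ _ mvstack).

(** Stacking turns the product law into one standard normal vector driving both source and noise, so
    that a single reflection acts on both. *)
Lemma joint_iid_standard_normal :
  exists2 P : probability 'cV[R]_(k1 + k2) R, iid_standard_normal P &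
    forall F : 'cV[R]_(k1 + k2) -> \bar R,
      measurable_fun setT F -> (forall z, 0 <= F z)%E ->
    (\int[P]_z F z = \int[P1]_z1 \int[P2]_z2 F (col_mx z1 z2))%E.
Proof.
exists (distribution (P1 \x P2)%E vstackX); last first.
  move=> F mF F0; rewrite ge0_integral_distribution// fubini_tonelli1//.
    exact: measurableT_comp mF mvstack.
  by move=> p; exact: F0.
move=> B mB; rewrite -[LHS]/((P1 \x P2)%E (vstack @^-1` box B)).
pose B1 i := B (lshift k2 i); pose B2 i := B (rshift k1 i).
rewrite (_ : _ @^-1` _ = box B1 `*` box B2); last first.
  apply/seteqP; split => -[z1 z2] /=.
    move=> zB; split=> i.
      by have := zB (lshift k2 i); rewrite /vstack col_mxEu.
    by have := zB (rshift k1 i); rewrite /vstack col_mxEd.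
  move=> [zB1 zB2] i; rewrite /vstack; case: (split_ordP i) => j ->.
    by rewrite col_mxEu; exact: zB1.
  by rewrite col_mxEd; exact: zB2.
have mB1 i : measurable (B1 i) by exact: mB.
have mB2 i : measurable (B2 i) by exact: mB.
rewrite product_measure1E; [|exact: measurable_box..].
rewrite -[LHS]/(P1 (box B1) * P2 (box B2))%E big_split_ord/=.
by rewrite -(iid1 mB1) -(iid2 mB2).
Qed.

End joint_law.

Lemma ge0_integral_linear_law (R : realType) (n k : nat)
    (P : probability 'cV[R]_n R) (PZ : probability 'cV[R]_k R) (S : 'M[R]_(n,
      k))
    (PE : forall U, measurable U -> P U = PZ [set z | U (S *m z)])
    (F : 'cV[R]_n -> \bar R) :
  measurable_fun setT F -> (forall x, 0 <= F x)%E ->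
  (\int[P]_x F x = \int[PZ]_z F (S *m z))%E.
Proof.
move=> mF F0; have mS : measurable_fun [set: 'cV[R]_k] (fun z => S *m z).
  exact: measurable_fun_mulmx.
rewrite -[RHS](@ge0_integral_pushforward _ _ _ _ _ _ mS PZ setT F)//.
by apply: eq_measure_integral => A mA _; exact: PE.
Qed.

(** * Measurability of integrals against a kernel *)

Section kernel_precomposition.
Context d1 d2 d3 (X : measurableType d1) (Y : measurableType d2)
  (Z : measurableType d3) (R : realType) (kappa : R.-pker Y ~> Z) (f : X -> Y).
Hypothesis mf : measurable_fun setT f.

(** The measurability proof is carried as an argument so that the kernel structure can be inferred
    from the term [kprecomp mf]. *)
Definition kprecomp (_ : measurable_fun setT f) (x : X) :
  {measure set Z -> \bar R} := kappa (f x).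

Let measurable_kprecomp U : measurable U ->
  measurable_fun [set: X] (kprecomp mf ^~ U).
Proof.
by move=> mU; exact: measurableT_comp (measurable_kernel kappa U mU) mf.
Qed.

HB.instance Definition _ := isKernel.Build _ _ _ _ _ (kprecomp mf)
  measurable_kprecomp.

Let kprecomp_prob x : kprecomp mf x [set: Z] = 1%E.
Proof. exact: prob_kernel. Qed.

HB.instance Definition _ := Kernel_isProbability.Build _ _ _ _ _
  (kprecomp mf) kprecomp_prob.

Lemma measurable_fun_integral_pker (g : X * Z -> \bar R) :
  measurable_fun setT g -> (forall p, 0 <= g p)%E ->
  measurable_fun setT (fun x => \int[kappa (f x)]_z g (x, z))%E.
Proof.
move=> mg g0.
exact: (measurable_fun_integral_sfinite_kernel g (kprecomp mf : R.-pker X ~>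
  Z)).
Qed.

End kernel_precomposition.

(** * Orthogonal decoupling *)

(** The cross terms cancel pointwise, before integration, so the identity holds even when both sides
    are infinite. *)
Lemma integral_sqrD_sqrB d (X : measurableType d) (R : realType)
    (nu : {measure set X -> \bar R}) (nuT : nu setT = 1%E) (x : R) (f : X ->
      R) :
  measurable_fun setT f ->
  (\int[nu]_u ((x + f u) ^+ 2)%:E + \int[nu]_u ((- x + f u) ^+ 2)%:E =
   2%:E * ((x ^+ 2)%:E + \int[nu]_u (f u ^+ 2)%:E))%E.
Proof.
move=> mf.
have msq (g : X -> R) : measurable_fun setT g ->
    measurable_fun setT (fun u => (g u ^+ 2)%:E).
  by move=> mg; apply/measurable_EFinP; exact: measurable_funX.
have sq0 (g : X -> R) u : setT u ->
  (0 <= (g u ^+ 2)%:E)%E by rewrite lee_fin sqr_ge0.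
have mD y : measurable_fun setT (fun u => y + f u) by exact: measurable_funD.
rewrite -(ge0_integralD nu measurableT (sq0 _) (msq _ (mD _)) (sq0 _) (msq _
  (mD _))).
have <- : (\int[nu]_u (x ^+ 2)%:E = (x ^+ 2)%:E)%E.
  by rewrite -[LHS]/(\int[nu]_u (cst (x ^+ 2)%:E u))%E integral_cst// nuT mule1.
have mc : measurable_fun setT (fun _ : X => (x ^+ 2)%:E) by exact:
  measurable_cst.
rewrite -(ge0_integralD nu measurableT (sq0 (cst x)) mc (sq0 f) (msq f mf)).
rewrite -ge0_integralZl//; last 2 first.
- by apply: emeasurable_funD => //; exact: msq.
- by move=> u _; rewrite -EFinD lee_fin addr_ge0// sqr_ge0.
apply: eq_integral => u _; rewrite -!EFinD -EFinM; congr EFin. rewrite /cst;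
  ring.
Qed.

(** [F] and its reflection have the same integral, so their sum integrates to twice that of [F].
    Doubling is injective on the extended reals, which covers infinite integrals. *)
Lemma integral_householder_average (R : realType) (k : nat) (P : probability
  'cV[R]_k R)
    (iidP : iid_standard_normal P) (a : 'cV[R]_k) (F G : 'cV[R]_k -> \bar R) :
    measurable_fun setT F -> (forall z, 0 <= F z)%E ->
    measurable_fun setT G -> (forall z, 0 <= G z)%E ->
    (forall z, F z + F (householder a z) = 2%:E * G z)%E ->
  (\int[P]_z F z = \int[P]_z G z)%E.
Proof.
move=> mF F0 mG G0 FG.
have mr : measurable_fun setT (fun z => F (householder a z)).
  exact: measurableT_comp mF (measurable_householder a).
have mul2I (x y : \bar R) : (2%:E * x = 2%:E * y -> x = y)%E.
  move=> /eqP; rewrite eq_le !lee_pmul2l// => xy.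
  by apply/eqP; rewrite eq_le.
apply: mul2I; rewrite -[RHS]ge0_integralZl// mule_natl mule2n.
rewrite -{2}(integral_householder iidP a mF F0) -ge0_integralD//.
by apply: eq_integral => z _.
Qed.

Section decoupling.
Variables (R : realType) (k p q r : nat) (P : probability 'cV[R]_k R).
Hypothesis iidP : iid_standard_normal P.
Variables (T : 'M[R]_(q,
  k)) (c : 'cV[R]_q) (kappa : R.-pker 'cV[R]_q ~> 'cV[R]_r).
Local Notation obs z := (T *m z + c).

Let mobs : measurable_fun [set: 'cV[R]_k] (fun z => obs z).
Proof. exact: measurable_linear. Qed.

(* The reflection along a fixes T z and negates dot a z, so the cross term of
   the square averages out; no integrability is needed. *)
Lemma decoupling_entry (a : 'cV[R]_k) (d : 'cV[R]_q * 'cV[R]_r -> R) :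
    T *m a = 0 -> measurable_fun setT d ->
  (\int[P]_z \int[kappa (obs z)]_u ((dot a z + d (obs z, u)) ^+ 2)%:E =
   \int[P]_z (dot a z ^+ 2)%:E +
   \int[P]_z \int[kappa (obs z)]_u (d (obs z, u) ^+ 2)%:E)%E.
Proof.
move=> Ta0 md.
have mdz : measurable_fun [set: 'cV[R]_k * 'cV[R]_r] (fun zu => d (obs zu.1,
  zu.2)).
  apply: (measurableT_comp md); apply: measurable_fun_pair => //.
  exact: measurableT_comp mobs measurable_fst.
have mdot : measurable_fun [set: 'cV[R]_k] (dot a) by exact: measurable_fun_dot.
have msq : measurable_fun setT (fun z => (dot a z ^+ 2)%:E).
  by apply/measurable_EFinP; exact: measurable_funX.
have mint (f : 'cV[R]_k -> R) : measurable_fun setT f -> measurable_fun setT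
    (fun z => \int[kappa (obs z)]_u ((f z + d (obs z, u)) ^+ 2)%:E)%E.
  move=> mf; apply: (measurable_fun_integral_pker kappa mobs
      (g := fun zu => ((f zu.1 + d (obs zu.1, zu.2)) ^+ 2)%:E)).
    apply/measurable_EFinP; apply: measurable_funX;
      apply: measurable_funD => //.
    exact: measurableT_comp mf measurable_fst.
  by move=> zu; rewrite lee_fin sqr_ge0.
have md2 : measurable_fun setT (fun z => \int[kappa (obs z)]_u (d (obs z,
  u) ^+ 2)%:E)%E.
  have := mint (cst 0) (measurable_cst _).
  by under eq_fun do under eq_integral do rewrite add0r.
have int0 z (f : 'cV[R]_r -> R) : (0 <= \int[kappa (obs z)]_u (f u ^+ 2)%:E)%E.
  by apply: integral_ge0 => u _; rewrite lee_fin sqr_ge0.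
have sq0 z : setT z -> (0 <= (dot a z ^+ 2)%:E)%E by rewrite lee_fin sqr_ge0.
rewrite -(ge0_integralD P measurableT sq0 msq (fun z _ => int0 z _) md2).
apply: (integral_householder_average iidP (a := a)).
- exact: mint.
- by move=> z; exact: int0.
- exact: emeasurable_funD.
- by move=> z; apply: adde_ge0; [exact: sq0|exact: int0].
- move=> z; rewrite mulmx_householder// dot_householder;
  apply: integral_sqrD_sqrB.
    exact: prob_kernel.
  exact: measurableT_comp md (pair1_measurable _).
Qed.

(** Entrywise reduction: [T *m E^T = 0] puts every transposed row of [E] in the kernel of [T], as
    [decoupling_entry] requires. *)
Lemma gaussian_decoupling (E : 'M[R]_(p, k)) (delta : 'cV[R]_q * 'cV[R]_r ->
  'cV[R]_p) :
    T *m E^T = 0 -> measurable_fun setT delta ->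
  (\int[P]_z \int[kappa (obs z)]_u (sqnorm (E *m z + delta (obs z, u)))%:E =
   \int[P]_z (sqnorm (E *m z))%:E +
   \int[P]_z \int[kappa (obs z)]_u (sqnorm (delta (obs z, u)))%:E)%E.
Proof.
move=> TE0 mdelta.
have mdz i : measurable_fun [set: 'cV[R]_k * 'cV[R]_r]
    (fun zu => delta (obs zu.1, zu.2) i ord0).
  apply: (measurable_fun_cVP _).1; apply: measurableT_comp mdelta _.
  apply: measurable_fun_pair => //; exact: measurableT_comp mobs measurable_fst.
have mdu z i : measurable_fun setT (fun u => delta (obs z, u) i ord0).
  apply: (measurable_fun_cVP _).1;
    exact: measurableT_comp mdelta (pair1_measurable _).
have mEz i : measurable_fun [set: 'cV[R]_k] (fun z => (E *m z) i ord0).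
  by apply: (measurable_fun_cVP _).1; exact: measurable_fun_mulmx.
have sqr0 (x : R) : (0 <= (x ^+ 2)%:E)%E by rewrite lee_fin sqr_ge0.
have sum_kappa (f : 'I_p -> 'cV[R]_k * 'cV[R]_r -> R) :
    (forall i, measurable_fun setT (f i)) ->
  (\int[P]_z \int[kappa (obs z)]_u (\sum_i f i (z, u) ^+ 2)%:E =
   \sum_i \int[P]_z \int[kappa (obs z)]_u (f i (z, u) ^+ 2)%:E)%E.
  move=> mf; rewrite -ge0_integral_sum//.
  - apply: eq_integral => z _; under eq_integral do rewrite -sumEFin.
    rewrite ge0_integral_sum// => i; apply/measurable_EFinP/measurable_funX.
    exact: measurableT_comp (mf i) (pair1_measurable _).
  - move=> i; apply: (measurable_fun_integral_pker kappa mobs (g :=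
    fun zu => (f i zu ^+ 2)%:E)) => //.
    exact/measurable_EFinP/measurable_funX.
  - by move=> i z _; apply: integral_ge0.
have -> : (\int[P]_z \int[kappa (obs z)]_u (sqnorm (E *m z + delta (obs z,
  u)))%:E =
    \sum_i \int[P]_z \int[kappa (obs z)]_u
      ((dot (row i E)^T z + delta (obs z, u) i ord0) ^+ 2)%:E)%E.
  rewrite -(sum_kappa (fun i zu => dot (row i E)^T zu.1 + delta (obs zu.1,
    zu.2) i ord0)).
    apply: eq_integral => z _; apply: eq_integral => u _; congr EFin.
    by apply: eq_bigr => i _; rewrite !mxE -mulmx_entry_dot mxE.
  by move=> i; apply: measurable_funD => //; exact: measurable_fun_dot.
rewrite [X in (_ + X)%E](sum_kappa (fun i zu => delta (obs zu.1,
  zu.2) i ord0))//.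
have -> : (\int[P]_z (sqnorm (E *m z))%:E =
  \sum_i \int[P]_z (dot (row i E)^T z ^+ 2)%:E)%E.
  rewrite -ge0_integral_sum//.
    apply: eq_integral => z _; rewrite sumEFin; congr EFin.
    by apply: eq_bigr => i _; rewrite mulmx_entry_dot.
  move=> i; apply/measurable_EFinP/measurable_funX.
  exact: measurable_fun_dot.
rewrite -big_split/=; apply: eq_bigr => i _.
apply: (decoupling_entry (d := fun yu => delta yu i ord0)).
  by rewrite tr_row colE mulmxA TE0 mul0mx.
exact: (measurable_fun_cVP _).1.
Qed.

End decoupling.

Lemma integral_sqnorm_gaussianD (R : realType) (k p : nat)
    (P : probability 'cV[R]_k R) (iidP : iid_standard_normal P)
    (E : 'M[R]_(p, k)) (v : 'cV[R]_p) :
  (\int[P]_z (sqnorm (E *m z + v))%:E =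
   \int[P]_z (sqnorm (E *m z))%:E + (sqnorm v)%:E)%E.
Proof.
(* Decoupling is applied to an empty observation, of dimension zero, with a trivial kernel. *)
pose kappa : R.-pker 'cV[R]_0 ~> 'cV[R]_0 :=
  kdirac (measurable_cst (0 : 'cV[R]_0)).
have cstE (y : 'cV[R]_0) (f : R) : (\int[kappa y]_u f%:E = f%:E)%E.
  by rewrite -[LHS]/(\int[kappa y]_u (cst f%:E u))%E integral_cst// prob_kernel
    mule1.
have PcstE (f : R) : (\int[P]_u f%:E = f%:E)%E.
  rewrite -[LHS]/(\int[P]_u (cst f%:E u))%E integral_cst//.
  by rewrite [X in (_ * X)%E]probability_setT mule1.
have := gaussian_decoupling iidP (T := (0 : 'M[R]_(0, k))) 0 kappa
  (E := E) (delta := fun=> v) (mul0mx _ _) (measurable_cst _).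
under eq_integral do rewrite cstE.
by under [X in (_ + X)%E]eq_integral do rewrite cstE; rewrite PcstE.
Qed.

(** * The signaling game *)

Lemma integral_kdirac d1 d2 (X : measurableType d1) (Y : measurableType d2)
    (R : realType) (phi : X -> Y) (mphi : measurable_fun setT phi) (x : X)
    (f : Y -> \bar R) : measurable_fun setT f ->
  (\int[kdirac mphi x]_y f y = f (phi x))%E.
Proof.
by move=> mf; rewrite -[LHS]/(\int[\d_(phi x)]_y f y)%E integral_dirac// diracT
  mul1e.
Qed.

Section deterministic_output.
Variables (R : realType) (n : nat) (g : policy R n).
Local Notation vec := 'cV[R]_n.

Let measurable_residual (v : vec) :
  measurable_fun [set: vec] (fun u => (sqnorm (v - u))%:E).
Proof.
by apply/measurable_EFinP; apply: measurable_fun_sqnorm;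
  exact: measurable_fun_cVB.
Qed.

(** A measurable set missing [v] lies in the exceptional null set, which forces the Dirac mass. *)
Lemma outputs_of_ae (x v : vec) :
  {ae g x, forall u, u = v} -> outputs g x v.
Proof.
case=> N [mN gN0 vN] U mU.
have null (A : set vec) : measurable A -> ~ A v -> g x A = 0%E.
  move=> mA Av; apply/eqP; rewrite eq_le measure_ge0 andbT -gN0.
  apply: le_measure; rewrite ?inE// => u Au; apply: vN => /= uv.
  by apply: Av; rewrite -uv.
have [Uv|nUv] := pselect (U v); last by rewrite null// diracE memNset.
have null_nU : g x (~` U) = 0%E.
  by apply: null; [exact: measurableC|move=> /(_ Uv)].
have gUT : (g x (U `|` ~` U) = g x U + g x (~` U))%E.
  exact: measureU (measurableC mU) (setICr U).
rewrite diracE mem_set//= -[LHS]adde0 -null_nU -gUT setUv; exact: prob_kernel.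
Qed.

Lemma outputs_of_residual0 (x v : vec) :
  (\int[g x]_u (sqnorm (v - u))%:E = 0)%E -> outputs g x v.
Proof.
move=> /(ge0_integral_eq0 (measurable_residual v)) res0; apply: outputs_of_ae.
have : {ae g x, forall u, (sqnorm (v - u))%:E = 0%E}.
  by apply: res0 => u; rewrite lee_fin sqnorm_ge0.
apply: filterS => u /eqP; rewrite eqe sqnorm_eq0 subr_eq0.
by move=> /eqP ->.
Qed.

Lemma outputs_integral (x v : vec) (f : vec -> \bar R) :
  measurable_fun setT f -> outputs g x v -> (\int[g x]_u f u = f v)%E.
Proof.
move=> mf gxv; transitivity (\int[\d_v]_u f u)%E.
  by apply: eq_measure_integral => A mA _; exact: gxv.
by rewrite integral_dirac// diracT mul1e.
Qed.

End deterministic_output.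

Section integrated_stage_costs.
Variables (R : realType) (n : nat) (PM PW : probability 'cV[R]_n R).
Local Notation vec := 'cV[R]_n.

Lemma measurable_noise_average (gd : policy R n) (f : vec -> vec -> vec -> R) :
    measurable_fun [set: (vec * vec) * vec] (fun p => f p.1.1 p.1.2 p.2) ->
    (forall m x u, 0 <= f m x u) ->
  measurable_fun [set: vec * vec]
    (fun p => \int[PW]_w \int[gd (p.2 + w)%R]_u (f p.1 p.2 u)%:E)%E.
Proof.
move=> mf f0.
have madd : measurable_fun [set: (vec * vec) * vec] (fun p => p.1.2 + p.2).
  apply: measurable_fun_cVD => //.
  exact: measurableT_comp measurable_snd measurable_fst.
apply: (measurable_fun_fubini_tonelli_F (m2 := PW)
  (fun p : (vec * vec) * vec => \int[gd (p.1.2 + p.2)%R]_u (f p.1.1 p.1.2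
    u)%:E)%E).
  apply: (measurable_fun_integral_pker gd madd
    (g := fun q : ((vec * vec) * vec) * vec => (f q.1.1.1 q.1.1.2 q.2)%:E)).
    have mq : measurable_fun setT (fun q : ((vec * vec) * vec) * vec => (q.1.1,
      q.2)).
      apply: measurable_fun_pair => //.
      exact: measurableT_comp measurable_fst measurable_fst.
    by apply/measurable_EFinP; exact: measurableT_comp mf mq.
  by move=> q; rewrite lee_fin.
by move=> p; apply: integral_ge0 => u _; rewrite lee_fin.
Qed.

Lemma expected_kdirac (phi : vec -> vec) (mphi : measurable_fun setT phi)
    (gd : policy R n) (f : vec -> vec -> vec -> R) :
    measurable_fun [set: (vec * vec) * vec] (fun p => f p.1.1 p.1.2 p.2) ->
    (forall m x u, 0 <= f m x u) ->
  (expected PM PW f (kdirac mphi : policy R n) gd =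
   \int[PM]_m \int[PW]_w \int[gd (phi m + w)%R]_u (f m (phi m) u)%:E)%E.
Proof.
move=> mf f0; apply: eq_integral => m _.
rewrite (integral_kdirac mphi m (f :=
  fun x => \int[PW]_w \int[gd (x + w)%R]_u (f m x u)%:E)%E)//.
exact: measurableT_comp (measurable_noise_average gd mf f0) (pair1_measurable
  m).
Qed.

Lemma measurable_residual_integral (gd : policy R n) (K : 'M[R]_n) (L : vec) :
  measurable_fun setT (fun y => \int[gd y]_u (sqnorm (K *m y + L - u))%:E)%E.
Proof.
pose f (p : vec * vec) := (sqnorm (K *m p.1 + L - p.2))%:E.
have mf : measurable_fun setT f.
  apply/measurable_EFinP; apply: measurable_fun_sqnorm.
  apply: measurable_fun_cVB => //.
  exact: measurableT_comp (measurable_linear K L) measurable_fst.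
have f0 p : (0 <= f p)%E by rewrite lee_fin sqnorm_ge0.
exact: (measurable_fun_integral_pker gd (f :=
  fun y => y) (@measurable_id _ vec setT) mf f0).
Qed.

End integrated_stage_costs.

Section gaussian_game.
Variables (R : realType) (n k1 k2 : nat) (PM PW : probability 'cV[R]_n R).
Variables (P1 : probability 'cV[R]_k1 R) (P2 : probability 'cV[R]_k2 R)
  (P : probability 'cV[R]_(k1 + k2) R).
Hypotheses (iid1 : iid_standard_normal P1) (iid2 : iid_standard_normal P2)
  (iidP : iid_standard_normal P).
Hypothesis jointP : forall F : 'cV[R]_(k1 + k2) -> \bar R,
  measurable_fun setT F -> (forall z, 0 <= F z)%E ->
  (\int[P]_z F z = \int[P1]_z1 \int[P2]_z2 F (col_mx z1 z2))%E.
Variables (S1 : 'M[R]_(n, k1)) (S2 : 'M[R]_(n, k2)).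
Hypothesis PM_law : forall U, measurable U -> PM U = P1 [set z | U (S1 *m z)].
Hypothesis PW_law : forall U, measurable U -> PW U = P2 [set z | U (S2 *m z)].
Local Notation vec := 'cV[R]_n.
Local Notation SigmaM := (S1 *m S1^T).
Local Notation SigmaW := (S2 *m S2^T).

(** [src] and [obs] give the source and the centred observation as matrices acting on the stacked
    vector (Z1, Z2), so that covariances become matrix products. *)
Let src : 'M[R]_(n, k1 + k2) := row_mx S1 0.
Let obs (A : 'M[R]_n) : 'M[R]_(n, k1 + k2) := row_mx (A *m S1) S2.

Let srcE (z : 'cV[R]_(k1 + k2)) : src *m z = S1 *m usubmx z.
Proof. by rewrite -{1}[z]vsubmxK mul_row_col mul0mx addr0. Qed.

Let obsE A (z : 'cV[R]_(k1 + k2)) : obs A *m z =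
  A *m (S1 *m usubmx z) + S2 *m dsubmx z.
Proof. by rewrite -{1}[z]vsubmxK mul_row_col mulmxA. Qed.

Let obs_cov A : obs A *m (obs A)^T = A *m SigmaM *m A^T + SigmaW.
Proof. by rewrite tr_row_mx mul_row_col trmx_mul !mulmxA. Qed.

Let src_obs_cov A : src *m (obs A)^T = SigmaM *m A^T.
Proof. by rewrite tr_row_mx mul_row_col mul0mx addr0 trmx_mul mulmxA. Qed.

Lemma integral_source_noise (F : vec * vec -> \bar R) :
  measurable_fun setT F -> (forall p, 0 <= F p)%E ->
  (\int[PM]_m \int[PW]_w F (m, w) =
   \int[P]_z F (S1 *m usubmx z, S2 *m dsubmx z))%E.
Proof.
move=> mF F0.
have mG : measurable_fun setT (fun m => \int[PW]_w F (m, w))%E.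
  exact: (measurable_fun_fubini_tonelli_F (m2 := PW) F).
have G0 m : (0 <= \int[PW]_w F (m, w))%E by exact: integral_ge0.
rewrite (ge0_integral_linear_law PM_law mG G0) jointP//; last first.
  apply: (measurableT_comp mF); apply: measurable_fun_pair.
    by under eq_fun do rewrite -srcE; exact: measurable_fun_mulmx.
  have noiseE (z : 'cV[R]_(k1 + k2)) : S2 *m dsubmx z =
    obs 0 *m z by rewrite obsE mul0mx add0r.
  under eq_fun do rewrite noiseE.
  exact: measurable_fun_mulmx.
apply: eq_integral => z1 _.
rewrite (ge0_integral_linear_law PW_law)//; last first.
  exact: measurableT_comp mF (pair1_measurable _).
by apply: eq_integral => z2 _; rewrite col_mxKu col_mxKd.
Qed.

Lemma integral_observation (A : 'M[R]_n) (C : vec) (f : vec -> \bar R) :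
  measurable_fun setT f -> (forall y, 0 <= f y)%E ->
  (\int[PM]_m \int[PW]_w f (A *m m + C + w)%R =
   \int[P]_z f (obs A *m z + C)%R)%E.
Proof.
move=> mf f0.
rewrite (integral_source_noise (F := fun p => f (A *m p.1 + C + p.2)))//.
  by apply: eq_integral => z _; rewrite obsE addrAC.
apply: (measurableT_comp mf); apply: measurable_fun_cVD => //.
exact: measurableT_comp (measurable_linear A C) measurable_fst.
Qed.

Lemma integral_sqnorm_source_lty (B : 'M[R]_n) (c : vec) :
  (\int[PM]_m (sqnorm (B *m m + c))%:E < +oo)%E.
Proof.
rewrite (ge0_integral_linear_law PM_law (F :=
  fun m => (sqnorm (B *m m + c))%:E)).
- under eq_integral do rewrite mulmxA.
  rewrite (integral_sqnorm_gaussianD iid1) lte_add_pinfty ?ltry//.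
  exact: integral_sqnorm_mulmx_lty.
- apply/measurable_EFinP; apply: measurable_fun_sqnorm.
  exact: measurable_linear.
- by move=> m; rewrite lee_fin sqnorm_ge0.
Qed.

(** * Optimal decoders for an affine encoder *)

Section decoder.
Variables (A K : 'M[R]_n) (C : vec).
Hypothesis mmseK : K *m (A *m SigmaM *m A^T + SigmaW) = SigmaM *m A^T.
Let L := - (K *m C).
Let err := src - K *m obs A.
Local Notation excess gd y := (\int[gd y]_u (sqnorm (K *m y + L - u))%:E)%E.

(** The normal equation [mmseK] says exactly that the error and the observation are uncorrelated. *)
Let obs_err : obs A *m err^T = 0.
Proof.
apply: trmx_inj; rewrite trmx_mul trmxK trmx0 mulmxBl -mulmxA.
by rewrite obs_cov src_obs_cov mmseK subrr.
Qed.

Let m_sqnormB : measurable_fun [set: (vec * vec) * vec]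
  (fun p => sqnorm (p.1.1 - p.2)).
Proof.
apply: measurable_fun_sqnorm; apply: measurable_fun_cVB => //.
exact: measurableT_comp measurable_fst measurable_fst.
Qed.

(** With y the observation, m - u is the error of the affine decoder plus K y + L - u, which depends
    on y and u only; decoupling then splits the cost. *)
Lemma Jd_affine_encoder (gd : policy R n) :
  (Jd PM PW (affine_policy A C) gd = \int[P]_z (sqnorm (err *m z))%:E +
    \int[PM]_m \int[PW]_w excess gd (A *m m + C + w)%R)%E.
Proof.
rewrite [LHS](expected_kdirac PM PW (measurable_linear A C) gd
  (f := fun m _ u => sqnorm (m - u)))//; last by move=> *; exact: sqnorm_ge0.
have mF : measurable_fun [set: vec * vec]
    (fun p => \int[gd (A *m p.1 + C + p.2)%R]_u (sqnorm (p.1 - u))%:E)%E.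
  have mobs : measurable_fun [set: vec * vec] (fun p => A *m p.1 + C + p.2).
    apply: measurable_fun_cVD => //.
    exact: measurableT_comp (measurable_linear A C) measurable_fst.
  apply: (measurable_fun_integral_pker gd mobs
    (g := fun q : (vec * vec) * vec => (sqnorm (q.1.1 - q.2))%:E)).
    exact/measurable_EFinP.
  by move=> q; rewrite lee_fin sqnorm_ge0.
have F0 p : (0 <= \int[gd (A *m p.1 + C + p.2)%R]_u (sqnorm (p.1 - u))%:E)%E.
  by apply: integral_ge0 => u _; rewrite lee_fin sqnorm_ge0.
apply: etrans (integral_source_noise mF F0) _.
rewrite (integral_observation _ _ (measurable_residual_integral gd K L));
  last first.
  by move=> p; apply: integral_ge0 => u _; rewrite lee_fin sqnorm_ge0.
have mdelta : measurable_fun [set: vec * vec] (fun p => K *m p.1 + L - p.2).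
  apply: measurable_fun_cVB => //.
  exact: measurableT_comp (measurable_linear K L) measurable_fst.
apply: etrans (gaussian_decoupling iidP C gd obs_err mdelta).
apply: eq_integral => z _; rewrite addrAC -obsE; apply: eq_integral => u _.
congr (sqnorm _)%:E; rewrite -srcE /err /L mulmxBl mulmxDr -mulmxA.
rewrite addrK addrA; congr (_ - _).
by rewrite subrK.
Qed.

Let excess_affine y : excess (affine_policy K L) y = 0%E.
Proof.
rewrite (integral_kdirac (measurable_linear K L)) ?subrr ?sqnorm0//.
by apply/measurable_EFinP; apply: measurable_fun_sqnorm;
  exact: measurable_fun_cVB.
Qed.

Lemma affine_decoder_optimal :
  optimal_decoder PM PW (affine_policy A C) (affine_policy K L).
Proof.
move=> gd; rewrite 2!Jd_affine_encoder; apply: leeD2l.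
under eq_integral do under eq_integral do rewrite excess_affine.
under eq_integral do rewrite integral0.
rewrite integral0; do 3 (apply: integral_ge0 => ? _).
by rewrite lee_fin sqnorm_ge0.
Qed.

(** The affine decoder has finite cost, which cancels from the comparison, so the mean squared
    distance to it must vanish. *)
Lemma optimal_decoder_excess0 (gd : policy R n) :
  optimal_decoder PM PW (affine_policy A C) gd ->
  (\int[PM]_m \int[PW]_w excess gd (A *m m + C + w)%R = 0)%E.
Proof.
move=> /(_ (affine_policy K L)); rewrite 2!Jd_affine_encoder.
under [X in (_ <= _ + X)%E]eq_integral do under eq_integral do rewrite
  excess_affine.
under [X in (_ <= _ + X)%E]eq_integral do rewrite integral0.
rewrite integral0 adde0 => le_err; apply/eqP; rewrite eq_le; apply/andP; split.
  have err_fin : (\int[P]_z (sqnorm (err *m z))%:E \is a fin_num)%E.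
    rewrite ge0_fin_numE; first exact: integral_sqnorm_mulmx_lty.
    by apply: integral_ge0 => z _; rewrite lee_fin sqnorm_ge0.
  by move: le_err; rewrite -[leRHS]adde0 leeD2lE.
by do 3 (apply: integral_ge0 => ? _); rewrite lee_fin sqnorm_ge0.
Qed.

Lemma optimal_decoder_outputs (gd : policy R n) :
  optimal_decoder PM PW (affine_policy A C) gd ->
  {ae (PM \x PW)%E, forall mw : vec * vec,
    outputs gd (A *m mw.1 + C + mw.2) (K *m (A *m mw.1 + C + mw.2) + L)}.
Proof.
move=> /optimal_decoder_excess0 ex0.
pose F (p : vec * vec) := excess gd (A *m p.1 + C + p.2)%R.
have F0 p : (0 <= F p)%E.
  by apply: integral_ge0 => u _; rewrite lee_fin sqnorm_ge0.
have mF : measurable_fun setT F.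
  apply: (measurableT_comp (measurable_residual_integral gd K L)).
  apply: measurable_fun_cVD => //.
  exact: measurableT_comp (measurable_linear A C) measurable_fst.
have : (\int[(PM \x PW)%E]_p F p = 0)%E by rewrite fubini_tonelli1.
move=> /(ge0_integral_eq0 mF F0).
by apply: filterS => p; exact: outputs_of_residual0.
Qed.

End decoder.

(** Normal equations for the transposed observation matrix with zero regularisation; a singular
    observation covariance is allowed. *)
Lemma mmse_gain (A : 'M[R]_n) : exists K : 'M[R]_n,
  K *m (A *m SigmaM *m A^T + SigmaW) = SigmaM *m A^T.
Proof.
have [G] := normal_equations (obs A)^T (lexx 0).
rewrite trmxK raddf0 addr0 => GE.
exists (src *m G^T); rewrite -obs_cov -src_obs_cov -mulmxA; congr (_ *m _).
by apply: trmx_inj; rewrite !trmx_mul !trmxK GE.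
Qed.

(** * Encoder costs *)

Section encoder.
Variables (b : vec) (lambda : R).
Hypothesis lambda_ge0 : 0 <= lambda.
Let stage (gd : policy R n) (m x : vec) : \bar R :=
  (\int[PW]_w \int[gd (x + w)%R]_u
     (sqnorm (m - u - b) + lambda * sqnorm x)%:E)%E.
(** Cost contributed by the amplified noise K W. It is finite and independent of x, and is kept real
    so that stage costs are compared in [R]. *)
Let noise (K : 'M[R]_n) : R :=
  fine (\int[P2]_z (sqnorm (- (K *m S2) *m z))%:E)%E.
Let cost (K : 'M[R]_n) (L m x : vec) : R :=
  noise K + (sqnorm (m - L - b - K *m x) + lambda * sqnorm x).

Let noiseE K : ((noise K)%:E = \int[P2]_z (sqnorm (- (K *m S2) *m z))%:E)%E.
Proof.
rewrite fineK// ge0_fin_numE; first exact: integral_sqnorm_mulmx_lty.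
by apply: integral_ge0 => z _; rewrite lee_fin sqnorm_ge0.
Qed.

Let noise_ge0 K : 0 <= noise K.
Proof.
rewrite -lee_fin noiseE; apply: integral_ge0 => z _.
by rewrite lee_fin sqnorm_ge0.
Qed.

Let cost_ge0 K L m x : 0 <= cost K L m x.
Proof. by rewrite !addr_ge0// ?mulr_ge0// sqnorm_ge0. Qed.

Let measurable_cost d (T : measurableType d) K L (f g : T -> vec) :
  measurable_fun setT f -> measurable_fun setT g ->
  measurable_fun setT (fun t => cost K L (f t) (g t)).
Proof.
move=> mf mg; apply: measurable_funD => //; apply: measurable_funD.
  apply: measurable_fun_sqnorm; apply: measurable_fun_cVB.
    by do 2 (apply: measurable_fun_cVB => //).
  exact: measurable_fun_mulmx.
by apply: measurable_funM => //; exact: measurable_fun_sqnorm.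
Qed.

Let m_integrand : measurable_fun [set: (vec * vec) * vec]
  (fun p => sqnorm (p.1.1 - p.2 - b) + lambda * sqnorm p.1.2).
Proof.
apply: measurable_funD.
  apply: measurable_fun_sqnorm; apply: measurable_fun_cVB => //.
  apply: measurable_fun_cVB => //.
  exact: measurableT_comp measurable_fst measurable_fst.
apply: measurable_funM => //; apply: measurable_fun_sqnorm.
exact: measurableT_comp measurable_snd measurable_fst.
Qed.

Let integrand_ge0 (m x u : vec) : 0 <= sqnorm (m - u - b) + lambda * sqnorm x.
Proof. by rewrite addr_ge0 ?mulr_ge0 ?sqnorm_ge0. Qed.

Let measurable_stage gd (phi : vec -> vec) : measurable_fun setT phi ->
  measurable_fun setT (fun m => stage gd m (phi m)).
Proof.
move=> mphi.
have mpair : measurable_fun setT (fun m : vec => (m, phi m)).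
  by apply: measurable_fun_pair.
exact: measurableT_comp (measurable_noise_average PW gd
  (f := fun m x u => sqnorm (m - u - b) + lambda * sqnorm x)
  m_integrand integrand_ge0) mpair.
Qed.

Let stage_ge0 gd m x : (0 <= stage gd m x)%E.
Proof. by do 2 (apply: integral_ge0 => ? _); rewrite lee_fin. Qed.

Let noise_average K (d : vec) :
  (\int[PW]_w (sqnorm (d - K *m w))%:E = (noise K + sqnorm d)%:E)%E.
Proof.
rewrite EFinD noiseE.
rewrite (ge0_integral_linear_law PW_law (F :=
  fun w => (sqnorm (d - K *m w))%:E)).
- rewrite -(integral_sqnorm_gaussianD iid2).
  by apply: eq_integral => z _; rewrite addrC mulNmx mulmxA.
- apply/measurable_EFinP; apply: measurable_fun_sqnorm.
  by apply: measurable_fun_cVB => //; exact: measurable_fun_mulmx.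
- by move=> w; rewrite lee_fin sqnorm_ge0.
Qed.

(** The decoder is assumed known only for almost every noise value, which also covers an equilibrium
    decoder determined almost surely. *)
Let stage_outputs gd K L m x :
  {ae PW, forall w, outputs gd (x + w) (K *m (x + w) + L)} ->
  stage gd m x = (cost K L m x)%:E.
Proof.
move=> gdo.
pose f u := (sqnorm (m - u - b) + lambda * sqnorm x)%:E.
have mf : measurable_fun setT f.
  apply/measurable_EFinP; apply: measurable_funD => //.
  by apply: measurable_fun_sqnorm; do 2 (apply: measurable_fun_cVB => //).
have mxw : measurable_fun setT (fun w : vec => x + w) by exact:
  measurable_fun_cVD.
have mfKL : measurable_fun setT (fun w => f (K *m (x + w) + L)).
  exact: measurableT_comp mf (measurableT_comp (measurable_linear K L) mxw).
transitivity (\int[PW]_w f (K *m (x + w) + L)%R)%E.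
  apply: ge0_ae_eq_integral => //.
  - apply: (measurable_fun_integral_pker gd mxw (g := fun p => f p.2)).
      exact: measurableT_comp mf measurable_snd.
    by move=> p; rewrite lee_fin.
  - by move=> w _; apply: integral_ge0 => u _; rewrite lee_fin.
  - by move=> w _; rewrite lee_fin.
  - by apply: filterS gdo => w gdw _; exact: outputs_integral.
have -> : (cost K L m x)%:E =
    ((noise K + sqnorm (m - L - b - K *m x))%:E + (lambda * sqnorm x)%:E)%E.
  by rewrite -EFinD -addrA.
rewrite -noise_average.
have <- : (\int[PW]_w (lambda * sqnorm x)%:E = (lambda * sqnorm x)%:E)%E.
  rewrite -[LHS]/(\int[PW]_w (cst (lambda * sqnorm x)%:E w))%E integral_cst//.
  by rewrite [X in (_ * X)%E]probability_setT mule1.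
rewrite -ge0_integralD//.
- apply: eq_integral => w _; rewrite /f EFinD; congr ((sqnorm _)%:E + _)%E.
  by rewrite mulmxDr !opprD !addrA [LHS](ACl (1*4*5*2*3)).
- by move=> w _; rewrite lee_fin sqnorm_ge0.
- apply/measurable_EFinP; apply: measurable_fun_sqnorm.
  by apply: measurable_fun_cVB => //; exact: measurable_fun_mulmx.
- by move=> w _; rewrite lee_fin mulr_ge0// sqnorm_ge0.
Qed.

Let stage_affine K L m x : stage (affine_policy K L) m x = (cost K L m x)%:E.
Proof. by apply: stage_outputs; apply: aeW => w U mU. Qed.

(** Gaussian second moments are finite; this finiteness permits the later cancellations of costs. *)
Let integral_cost_affine_lty K L A C :
  (\int[PM]_m (cost K L m (A *m m + C))%:E < +oo)%E.
Proof.
have mA : measurable_fun setT (fun m : vec => A *m m + C) by exact: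
  measurable_linear.
rewrite /cost; under eq_integral do rewrite EFinD EFinD.
have msq (g : vec -> vec) : measurable_fun setT g ->
    measurable_fun setT (fun m => (sqnorm (g m))%:E).
  by move=> mg; apply/measurable_EFinP; exact: measurable_fun_sqnorm.
have mres : measurable_fun setT (fun m : vec => m - L - b - K *m (A *m m + C)).
  apply: measurable_fun_cVB; last exact: measurable_fun_mulmx.
  by do 2 (apply: measurable_fun_cVB => //).
have mlam : measurable_fun setT (fun m : vec => (lambda * sqnorm (A *m m +
  C))%:E).
  by apply/measurable_EFinP/measurable_funM => //; exact: measurable_fun_sqnorm.
rewrite ge0_integralD//; last 3 first.
- by move=> m _; rewrite lee_fin.
- by move=> m _; rewrite -EFinD lee_fin addr_ge0 ?mulr_ge0 ?sqnorm_ge0.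
- by apply: emeasurable_funD => //; exact: msq.
apply: lte_add_pinfty.
  rewrite -[X in (X < _)%E]/(\int[PM]_m (cst (noise K)%:E m))%E integral_cst//.
  by rewrite [X in (_ * X)%E]probability_setT mule1 ltry.
rewrite ge0_integralD//; last 3 first.
- by move=> m _; rewrite lee_fin sqnorm_ge0.
- exact: msq.
- by move=> m _; rewrite lee_fin mulr_ge0 ?sqnorm_ge0.
apply: lte_add_pinfty.
  have resE m : m - L - b - K *m (A *m m + C) =
      (1%:M - K *m A) *m m + (- (L + b) - K *m C).
    by rewrite mulmxBl mul1mx mulmxDr mulmxA !opprD !addrA [LHS](ACl
      (1*4*2*3*5)).
  by under eq_integral do rewrite resE; exact: integral_sqnorm_source_lty.
under eq_integral do rewrite EFinM.
rewrite ge0_integralZl//; last 2 first.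
- exact: msq.
- by move=> m _; rewrite lee_fin sqnorm_ge0.
by rewrite lte_mul_pinfty// ?lee_fin//; exact: integral_sqnorm_source_lty.
Qed.

Lemma Je_stage ge gd : Je PM PW b lambda ge gd =
  (\int[PM]_m \int[ge m]_x stage gd m x)%E.
Proof. by []. Qed.

Lemma Je_kdirac phi (mphi : measurable_fun setT phi) gd :
  (Je PM PW b lambda (kdirac mphi : policy R n) gd =
    \int[PM]_m stage gd m (phi m))%E.
Proof.
exact: (expected_kdirac PM PW mphi gd
  (f := fun m x u => sqnorm (m - u - b) + lambda * sqnorm x) m_integrand
    integrand_ge0).
Qed.

(** * Best responses to an affine decoder *)

Section best_response.
Variables (K G : 'M[R]_n) (L : vec).
Hypothesis normalG : (K^T *m K + lambda%:M) *m G = K^T.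
(** With this constant, G m + C = G (m - L - b) solves the normal equations for the target m - L -
    b. *)
Let C := - (G *m (L + b)).
Let regret (m x : vec) : R :=
  sqnorm (K *m (x - (G *m m + C))) + lambda * sqnorm (x - (G *m m + C)).

Let regret_ge0 m x : 0 <= regret m x.
Proof. by rewrite addr_ge0 ?mulr_ge0 ?sqnorm_ge0. Qed.

Let costE m x : cost K L m x = cost K L m (G *m m + C) + regret m x.
Proof.
rewrite /cost (complete_square (v := m - L - b) x (x0 := G *m m + C)) ?addrA//.
by rewrite /C -mulmxBr mulmxA normalG opprD addrA.
Qed.

Let optimum_ge0 m : (0 <= (cost K L m (G *m m + C))%:E)%E.
Proof. by rewrite lee_fin. Qed.

Let regret_ge0E m x : (0 <= (regret m x)%:E)%E.
Proof. by rewrite lee_fin. Qed.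

Let measurable_regret : measurable_fun [set: vec * vec] (fun p => (regret p.1
  p.2)%:E).
Proof.
have md : measurable_fun [set: vec * vec] (fun p => p.2 - (G *m p.1 + C)).
  apply: measurable_fun_cVB => //.
  exact: measurableT_comp (measurable_linear G C) measurable_fst.
apply/measurable_EFinP; apply: measurable_funD.
  by apply: measurable_fun_sqnorm; exact: measurable_fun_mulmx.
by apply: measurable_funM => //; exact: measurable_fun_sqnorm.
Qed.

Let measurable_regret1 m : measurable_fun setT (fun x => (regret m x)%:E).
Proof. exact: measurableT_comp measurable_regret (pair1_measurable m). Qed.

Let measurable_optimum :
  measurable_fun setT (fun m => (cost K L m (G *m m + C))%:E).
Proof. by apply/measurable_EFinP; apply: measurable_cost => //;
  exact: measurable_linear. Qed.

Let integral_regret_ge0 (ge : policy R n) m : (0 <= \int[ge m]_x (regret m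
  x)%:E)%E.
Proof. by apply: integral_ge0 => x _; rewrite lee_fin. Qed.

Let measurable_integral_regret (ge : policy R n) :
  measurable_fun setT (fun m => \int[ge m]_x (regret m x)%:E)%E.
Proof.
exact: (measurable_fun_integral_pker ge (f :=
  fun m => m) (@measurable_id _ vec setT)
  measurable_regret (fun p => regret_ge0E p.1 p.2)).
Qed.

(** The square is completed for each message and then integrated; only the regret depends on the
    encoder. *)
Lemma Je_affine_decoder (ge : policy R n) :
  (Je PM PW b lambda ge (affine_policy K L) =
   \int[PM]_m (cost K L m (G *m m + C))%:E +
   \int[PM]_m \int[ge m]_x (regret m x)%:E)%E.
Proof.
rewrite Je_stage -(ge0_integralD PM measurableT (fun m _ => optimum_ge0 m)
  measurable_optimum (fun m _ => integral_regret_ge0 ge m)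
    (measurable_integral_regret ge)).
apply: eq_integral => m _;
  under eq_integral do rewrite stage_affine costE EFinD.
have mc : measurable_fun setT (fun _ : vec => (cost K L m (G *m m + C))%:E).
  exact: measurable_cst.
rewrite (ge0_integralD (ge m) measurableT (fun _ _ => optimum_ge0 m) mc
  (fun x _ => regret_ge0E m x) (measurable_regret1 m)); congr (_ + _)%E.
rewrite -[LHS]/(\int[ge m]_x (cst (cost K L m (G *m m + C))%:E x))%E
  integral_cst//.
by rewrite [X in (_ * X)%E]prob_kernel mule1.
Qed.

Let integral_regret_affine m :
  (\int[(affine_policy G C : policy R n) m]_x (regret m x)%:E = 0)%E.
Proof.
rewrite (integral_kdirac (measurable_linear G C) m (measurable_regret1 m)).
by rewrite /regret subrr mulmx0 !sqnorm0 mulr0 addr0.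
Qed.

Lemma affine_encoder_optimal :
  optimal_encoder PM PW b lambda (affine_policy K L) (affine_policy G C).
Proof.
move=> ge; rewrite 2!Je_affine_decoder; apply: leeD2l.
under eq_integral do rewrite integral_regret_affine.
by rewrite integral0; apply: integral_ge0 => m _.
Qed.

(** Zero regret forces K d = 0 and lambda d = 0 for the deviation d from the affine action. The Gram
    matrix then kills d, and its invertibility gives d = 0. *)
Lemma optimal_encoder_outputs (ge : policy R n) :
  K^T *m K + lambda%:M \in unitmx ->
  optimal_encoder PM PW b lambda (affine_policy K L) ge ->
  {ae PM, forall m, outputs ge m (G *m m + C)}.
Proof.
move=> Hunit /(_ (affine_policy G C)); rewrite 2!Je_affine_decoder.
under [X in (_ <= _ + X)%E]eq_integral do rewrite integral_regret_affine.
rewrite integral0 adde0 => le_opt.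
have := ge0_integralD_le_ae measurable_optimum (measurable_integral_regret ge)
  optimum_ge0 (integral_regret_ge0 ge) le_opt
  (integral_cost_affine_lty K L G C).
apply: filterS => m.
move=> /(ge0_integral_eq0 (measurable_regret1 m) (regret_ge0E m)) reg0.
apply: outputs_of_ae; apply: filterS reg0 => x [].
move=> /(gram_form_eq0 lambda_ge0)[Kd0 ld0].
apply/eqP; rewrite -subr_eq0; apply/eqP.
rewrite -[LHS](mulKmx Hunit) mulmxDl -mulmxA Kd0 mulmx0 mul_scalar_mx ld0.
by rewrite addr0 mulmx0.
Qed.

End best_response.

(** * Stationarity of equilibrium encoders *)

Section stationarity.
Variables (A K : 'M[R]_n) (C : vec) (gd : policy R n).
Hypothesis eq_nash : nash PM PW b lambda (affine_policy A C) gd.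
Hypothesis obs_unit : A *m SigmaM *m A^T + SigmaW \in unitmx.
Hypothesis mmseK : K *m (A *m SigmaM *m A^T + SigmaW) = SigmaM *m A^T.
Let L := - (K *m C).
Let excess y := (\int[gd y]_u (sqnorm (K *m y + L - u))%:E)%E.

Let excess_ge0 y : (0 <= excess y)%E.
Proof. by apply: integral_ge0 => u _; rewrite lee_fin sqnorm_ge0. Qed.

Let measurable_excess : measurable_fun setT excess.
Proof. exact: measurable_residual_integral. Qed.

(* The optimal decoder is only known almost surely along the equilibrium path.
   As the observation has full-rank covariance, a constant shift d of the
   encoder shifts the underlying standard normal vector, whose law is
   quasi-invariant. *)
Let shifted_stage (d : vec) : {ae PM, forall m,
  stage gd m (A *m m + (C + d)) = (cost K L m (A *m m + (C + d)))%:E}.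
Proof.
(* A vector of the underlying normal space that the observation matrix maps to [d], available
   because the observation covariance is invertible. *)
pose a := (obs A)^T *m invmx (A *m SigmaM *m A^T + SigmaW) *m d.
have obs_a : obs A *m a =
  d by rewrite /a mulmxA [obs A *m (_ *m _)]mulmxA obs_cov mulmxV// mul1mx.
have mobs c : measurable_fun setT (fun z => excess (obs A *m z + c)).
  exact: measurableT_comp measurable_excess (measurable_linear (obs A) c).
have ex0 : (\int[P]_z excess (obs A *m z + C)%R = 0)%E.
  rewrite -(integral_observation A C measurable_excess excess_ge0).
  exact: (optimal_decoder_excess0 mmseK (proj2 eq_nash)).
have {}ex0 : (\int[PM]_m \int[PW]_w excess (A *m m + (C + d) + w)%R = 0)%E.
  rewrite (integral_observation A (C + d) measurable_excess excess_ge0).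
  have <- := integral_shift_eq0 iidP a (mobs C) (fun z => excess_ge0 _) ex0.
  by apply: eq_integral => z _; rewrite mulmxDr obs_a -addrA (addrC d).
have mF : measurable_fun [set: vec * vec]
    (fun p => excess (A *m p.1 + (C + d) + p.2)%R).
  apply: (measurableT_comp measurable_excess); apply: measurable_fun_cVD => //.
  exact: measurableT_comp (measurable_linear A (C + d)) measurable_fst.
have mI : measurable_fun setT (fun m => \int[PW]_w excess (A *m m + (C + d) +
  w)%R)%E.
  exact: (measurable_fun_fubini_tonelli_F (m2 :=
    PW) _ mF (fun p => excess_ge0 _)).
have I0 m : (0 <= \int[PW]_w excess (A *m m + (C + d) + w)%R)%E.
  by apply: integral_ge0 => w _.
apply: filterS (ge0_integral_eq0 mI I0 ex0) => m exm.
have mFm : measurable_fun setT (fun w => excess (A *m m + (C + d) + w)%R).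
  exact: measurableT_comp mF (pair1_measurable m).
apply: stage_outputs;
  apply: filterS (ge0_integral_eq0 mFm (fun w => excess_ge0 _) exm).
by move=> w; exact: outputs_of_residual0.
Qed.

(* Otherwise the encoder gains by adding d to its output exactly on the set of
   messages where this lowers the cost. *)
Let no_profitable_shift (d : vec) : {ae PM, forall m,
  cost K L m (A *m m + C) <= cost K L m (A *m m + (C + d))}.
Proof.
pose x0 (m : vec) := A *m m + C.
pose x1 (m : vec) := A *m m + (C + d).
have mx0 : measurable_fun setT x0 by exact: measurable_linear.
have mx1 : measurable_fun setT x1 by exact: measurable_linear.
pose c0 m := cost K L m (x0 m).
pose c1 m := cost K L m (x1 m).
have mc0 : measurable_fun setT c0 by exact: measurable_cost.
have mc1 : measurable_fun setT c1 by exact: measurable_cost.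
pose phi m := if c1 m < c0 m then x1 m else x0 m.
have mphi : measurable_fun setT phi.
  by apply: measurable_fun_ifT => //; exact: measurable_fun_ltr.
pose c m := cost K L m (phi m).
have mc : measurable_fun setT c by exact: measurable_cost.
have c_le m : c m <= c0 m.
  by rewrite /c /phi; case: ifPn => // /ltW.
(* The shift by zero identifies the stage cost on the equilibrium path itself. *)
have shift0 : {ae PM, forall m, stage gd m (x0 m) = (c0 m)%:E}.
  by apply: filterS (shifted_stage 0) => m; rewrite addr0.
have stage_phi : {ae PM, forall m, stage gd m (phi m) = (c m)%:E}.
  move: shift0 (shifted_stage d); apply: filterS2 => m s0 s1.
  by rewrite /c /phi; case: ifP.
have Je0 : (Je PM PW b lambda (affine_policy A C) gd = \int[PM]_m (c0 m)%:E)%E.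
  rewrite Je_kdirac; apply: ge0_ae_eq_integral => //.
  - exact: measurable_stage.
  - by apply/measurable_EFinP; exact: mc0.
  - by move=> m _; rewrite lee_fin; exact: cost_ge0.
  - by apply: filterS shift0.
have Jephi : (Je PM PW b lambda (kdirac mphi : policy R n) gd =
  \int[PM]_m (c m)%:E)%E.
  rewrite Je_kdirac; apply: ge0_ae_eq_integral => //.
  - exact: measurable_stage.
  - by apply/measurable_EFinP; exact: mc.
  - by move=> m _; rewrite lee_fin; exact: cost_ge0.
  - by apply: filterS stage_phi.
have mcE : measurable_fun setT (fun m => (c m)%:E) by exact/measurable_EFinP.
have mgE : measurable_fun setT (fun m => (c0 m - c m)%:E).
  by apply/measurable_EFinP; exact: measurable_funB.
have cE0 m : (0 <= (c m)%:E)%E by rewrite lee_fin; exact: cost_ge0.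
have gE0 m : (0 <= (c0 m - c m)%:E)%E by rewrite lee_fin subr_ge0; exact: c_le.
have c0_lty : (\int[PM]_m (c0 m)%:E < +oo)%E by exact: integral_cost_affine_lty.
have c0E : (\int[PM]_m (c0 m)%:E =
  \int[PM]_m (c m)%:E + \int[PM]_m (c0 m - c m)%:E)%E.
  rewrite -(ge0_integralD PM measurableT (fun m _ => cE0 m) mcE (fun m _ => gE0
    m) mgE).
  by apply: eq_integral => m _; rewrite -EFinD subrKC.
have c_lty : (\int[PM]_m (c m)%:E < +oo)%E.
  by apply: le_lt_trans c0_lty; rewrite c0E leeDl// integral_ge0.
have := proj1 eq_nash (kdirac mphi : policy R n); rewrite Je0 Jephi c0E => le_c.
(* Almost surely [c] equals [c0], which excludes the branch where [phi] strictly lowers the cost. *)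
apply: filterS (ge0_integralD_le_ae mcE mgE cE0 gE0 le_c c_lty) => m [].
rewrite /c /phi leNgt; case: ifPn => // lt10 /eqP.
by rewrite subr_eq0 -/(c1 m) gt_eqF.
Qed.

(** Half the gradient of the cost with respect to x, taken at the equilibrium action. *)
Let gradient (m : vec) : vec :=
  (K^T *m K + lambda%:M) *m (A *m m + C) - K^T *m (m - L - b).

Let costD m x d : cost K L m (x + d) = cost K L m x +
  (2 * dot d ((K^T *m K + lambda%:M) *m x - K^T *m (m - L - b)) +
   (sqnorm (K *m d) + lambda * sqnorm d)).
Proof. by rewrite /cost (regularized_residualD K lambda (m - L - b) x d)
  !addrA. Qed.

(** The exceptional null set depends on the step t, so only the countably many steps 1/(k+1) and
    -1/(k+1) are used. Dividing by t and letting it tend to zero bounds the entry on both sides. *)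
Let gradient_ae (i : 'I_n) : {ae PM, forall m, gradient m i ord0 = 0}.
Proof.
pose e : vec := delta_mx i ord0.
pose r := sqnorm (K *m e) + lambda * sqnorm e.
have step t : {ae PM, forall m, 0 <= t * (2 * gradient m i ord0 + t * r)}.
  apply: filterS (no_profitable_shift (t *: e)) => m.
  rewrite addrA (costD _ _ (t *: e)) lerDl -/(gradient m) -scalemxAr !sqnormZ
    dotZl.
  have -> : dot e (gradient m) = gradient m i ord0.
    rewrite /dot (bigD1 i)//= mxE !eqxx mul1r big1 ?addr0// => j ji.
    by rewrite mxE (negbTE ji) mul0r.
  by congr (0 <= _); rewrite /r; ring.
have steps : {ae PM, forall m, forall k : nat,
    0 <= k.+1%:R^-1 * (2 * gradient m i ord0 + k.+1%:R^-1 * r) /\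
    0 <= - k.+1%:R^-1 * (2 * gradient m i ord0 + - k.+1%:R^-1 * r)}.
  apply/ae_foralln => k; move: (step k.+1%:R^-1) (step (- k.+1%:R^-1)).
  by apply: filterS2 => m.
have archi (x : R) : (forall k, x <= k.+1%:R^-1 * r) -> x <= 0.
  move=> xr; rewrite leNgt; apply/negP => x0.
  have := xr (Num.truncn (r / x)); apply/negP;
    rewrite -ltNge mulrC ltr_pdivrMr//.
  by rewrite mulrC -ltr_pdivrMr// truncnS_gt.
apply: filterS steps => m g0.
have inv0 k : 0 < k.+1%:R^-1 :> R by rewrite invr_gt0.
suff : 2 * gradient m i ord0 <= 0 /\ - (2 * gradient m i ord0) <= 0 by lra.
split; apply: archi => k; have [] := g0 k; move: (inv0 k);
    move: (_^-1) => t t0 h1 h2.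
  by move: h2; rewrite mulNr -mulrN pmulr_rge0//; lra.
by move: h1; rewrite pmulr_rge0//; lra.
Qed.

(** The gradient is affine in m and vanishes almost surely. Comparing it at Z1 and at Z1 shifted by
    a basis vector isolates a column of [B *m S1]. Since [SigmaM] may be singular, the equation
    keeps it as a factor. *)
Lemma nash_stationary :
  (K^T *m K + lambda%:M) *m A *m SigmaM = K^T *m SigmaM.
Proof.
pose B := (K^T *m K + lambda%:M) *m A - K^T.
pose g0 := (K^T *m K + lambda%:M) *m C + K^T *m (L + b).
have gradientE m : gradient m = B *m m + g0.
  rewrite /gradient /B /g0 -[m - L - b]addrA -opprD mulmxBl mulmxBr mulmxDr
    mulmxA.
  by rewrite opprB !addrA [LHS](ACl (1*4*2*3)).
suff BS1 : B *m S1 = 0.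
  apply/eqP; rewrite -subr_eq0 -mulmxBl -/B mulmxA BS1 mul0mx//.
apply/matrixP => i j; rewrite [RHS]mxE.
pose e : 'cV[R]_k1 := delta_mx j ord0.
pose beta (z : 'cV[R]_k1) := (B *m S1 *m z + g0) i ord0.
pose h z := (beta z ^+ 2)%:E.
have mh : measurable_fun setT h.
  apply/measurable_EFinP; apply: measurable_funX.
  by apply: (measurable_fun_cVP _).1; exact: measurable_linear.
have h0 z : (0 <= h z)%E by rewrite lee_fin sqr_ge0.
have mg : measurable_fun setT (fun m => (gradient m i ord0 ^+ 2)%:E).
  under eq_fun do rewrite gradientE.
  apply/measurable_EFinP; apply: measurable_funX.
  by apply: (measurable_fun_cVP _).1; exact: measurable_linear.
have inth : (\int[P1]_z h z = 0)%E.
  transitivity (\int[PM]_m (gradient m i ord0 ^+ 2)%:E)%E.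
    rewrite (ge0_integral_linear_law PM_law mg); last first.
      by move=> m; rewrite lee_fin sqr_ge0.
    by apply: eq_integral => z _; rewrite gradientE mulmxA.
  transitivity (\int[PM]_m cst 0 m)%E; last exact: integral0.
  apply: ge0_ae_eq_integral => //.
    by move=> m _; rewrite lee_fin sqr_ge0.
  by apply: filterS (gradient_ae i) => m gm _; rewrite gm expr0n.
have mze : measurable_fun setT (fun z : 'cV[R]_k1 => z + e).
  exact: measurable_fun_cVD.
have mhe : measurable_fun setT (fun z : 'cV[R]_k1 => h (z + e)).
  exact: measurableT_comp mh mze.
have h_ae := ge0_integral_eq0 mh h0 inth.
have he_ae := ge0_integral_eq0 mhe (fun z => h0 _) (integral_shift_eq0 iid1 e
  mh h0 inth).
have : {ae P1, forall _, (B *m S1) i j = 0}.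
  move: h_ae he_ae; apply: filterS2 => z [] /eqP;
    rewrite sqrf_eq0 => /eqP bz [] /eqP.
  rewrite sqrf_eq0 => /eqP; rewrite /beta mulmxDr addrAC mxE.
  rewrite -/(beta z) bz add0r => <-.
  by rewrite /e -colE [RHS]mxE.
(* A constant statement true almost surely is true: otherwise the null set would be the whole space,
   of mass one. *)
case=> N [mN PN0 BN]; apply/eqP; apply: contraT => /eqP nz.
have NT : N = setT by apply/seteqP; split => // z _; exact: BN.
have := @probability_setT _ _ _ P1; rewrite -NT PN0 => -[] /eqP.
by rewrite eq_sym oner_eq0.
Qed.

End stationarity.

End encoder.

End gaussian_game.

(** * Assembly of the decoder, encoder, fixed-point and existence claims *)

Theorem theoremV1 (R : realType) (n : nat)
    (PM PW : probability 'cV[R]_n R) (SigmaM SigmaW : 'M[R]_n)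
    (b : 'cV[R]_n) (lambda : R)
    (gaussM : centered_gaussian PM SigmaM)
    (gaussW : centered_gaussian PW SigmaW)
    (lambda_ge0 : 0 <= lambda) :
  [/\ (* (1) *)
      forall (A : 'M[R]_n) (C : 'cV[R]_n),
      exists (K : 'M[R]_n) (L : 'cV[R]_n),
        [/\ C = 0 -> L = 0,
            optimal_decoder PM PW (affine_policy A C) (affine_policy K L) &
            forall gd : policy R n,
              optimal_decoder PM PW (affine_policy A C) gd ->
              {ae (PM \x PW)%E, forall mw : 'cV[R]_n * 'cV[R]_n,
                let y := A *m mw.1 + C + mw.2 in outputs gd y (K *m y + L)}],
      (* (2) *)
      forall (K : 'M[R]_n) (L : 'cV[R]_n),
      exists (A : 'M[R]_n) (C : 'cV[R]_n),
        optimal_encoder PM PW b lambda (affine_policy K L) (affine_policy A C) /\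
        (K^T *m K + lambda%:M \in unitmx ->
         forall ge : policy R n,
           optimal_encoder PM PW b lambda (affine_policy K L) ge ->
           {ae PM, forall m : 'cV[R]_n, outputs ge m (A *m m + C)}),
      (* (3) *)
      forall (A : 'M[R]_n) (C : 'cV[R]_n) (gd : policy R n),
        nash PM PW b lambda (affine_policy A C) gd ->
        A *m SigmaM *m A^T + SigmaW \in unitmx ->
        let F := Fmap SigmaM SigmaW A in
        (F *m F^T + lambda%:M) *m A *m SigmaM = F *m SigmaM /\
        (SigmaM \in unitmx -> F *m F^T + lambda%:M \in unitmx ->
         A = Tmap lambda SigmaM SigmaW A) &
      (* (4) *)
      exists ge gd : policy R n, nash PM PW b lambda ge gd].
Proof.
case: gaussM => k1 [S1 [P1 [iid1 <- PM_law]]].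
case: gaussW => k2 [S2 [P2 [iid2 <- PW_law]]].
have [P iidP jointP] := joint_iid_standard_normal iid1 iid2.
split.
- move=> A C; have [K mmseK] := mmse_gain S1 S2 A.
  exists K, (- (K *m C)); split.
  + by move=> ->; rewrite mulmx0 oppr0.
  + exact: (affine_decoder_optimal iidP jointP PM_law PW_law C mmseK).
  + exact: (optimal_decoder_outputs iidP jointP PM_law PW_law mmseK).
- move=> K L; have [G normalG] := normal_equations K lambda_ge0.
  exists G, (- (G *m (L + b))); split.
    exact: (affine_encoder_optimal PM iid2 PW_law b lambda_ge0 L normalG).
  move=> gram_unit ge.
  exact: (optimal_encoder_outputs iid1 iid2 PM_law PW_law).
- move=> A C gd eq_nash obs_unit F; have [K mmseK] := mmse_gain S1 S2 A.
  (* [F] solves the transposed normal equation, so it is the transpose of the decoder gain, and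
     stationarity becomes an equation in [F]. *)
  have FE : F = K^T.
    rewrite /F /Fmap -mulmxA -[RHS](mulKmx obs_unit); congr (_ *m _).
    have symM : (S1 *m S1^T)^T = S1 *m S1^T by rewrite trmx_mul trmxK.
    apply: trmx_inj; rewrite !trmx_mul !trmxK -mmseK; congr (_ *m _).
    by rewrite linearD/= !trmx_mul !trmxK !mulmxA.
  have stat := nash_stationary iid1 iid2 iidP jointP PM_law PW_law lambda_ge0
    eq_nash obs_unit mmseK.
  rewrite FE trmxK; split=> // SigmaM_unit gram_unit.
  rewrite /Tmap -/F FE trmxK -[LHS](mulKmx gram_unit); congr (_ *m _).
  by rewrite -[LHS](mulmxK SigmaM_unit) stat mulmxK.
(* With zero gains both normal equations reduce to 0 = 0, and the bias [b] enters the best response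
   only through G (L + b), which vanishes. *)
- exists (affine_policy 0 0), (affine_policy 0 0); split.
    have := affine_encoder_optimal PM iid2 PW_law b lambda_ge0
      (K := 0) (G := 0) 0.
    by rewrite (mul0mx _ (0 + b)) oppr0; apply; rewrite mulmx0 trmx0.
  have := affine_decoder_optimal iidP jointP PM_law PW_law (A := 0) (K := 0) 0.
  by rewrite (mul0mx _ 0) oppr0; apply; rewrite mul0mx trmx0 mulmx0.
Qed.
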